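(* There is an algorithm which, given a connected graph $G$ of diameter two and a vertex $r$ of $G$, decides in time polynomial in $|V(G)|$ whether $G$ is $r$-stackable.
   Context: All graphs are finite, simple and connected. A configuration on $G$ is a function $C:V(G)\to\mathbb{N}$ (numbers of cups). A cup stacking move from $u$ to $v$ is allowed when $C(u)\ge1$, $C(v)\ge1$ and $\mathrm{dist}_G(u,v)=C(u)$; it moves all cups of $u$ onto $v$. Let $\mathbf{1}$ be the configuration with exactly one cup on every vertex. $G$ is $r$-stackable if some finite sequence of moves starting from $\mathbf{1}$ puts all cups on $r$. *)

(* Defs.v *)
From Stdlib Require Import Relation_Operators.
From mathcomp Require Import all_boot.

Set Implicit Arguments.
Unset Strict Implicit.
Unset Printing Implicit Defensive.

(** A graph is an irreflexive symmetric relation [e] on a [finType]. *)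

Definition walk (T : finType) (e : rel T) (k : nat) (x y : T) : bool :=
  [exists p : k.-tuple T, path e x p && (last x p == y)].

(** Least length of a walk from [x] to [y].  Lengths below [#|T|] suffice, as a
    shortest walk repeats no vertex; the value is [#|T|] when [y] cannot be
    reached from [x]. *)
Definition dist (T : finType) (e : rel T) (x y : T) : nat :=
  find (fun k => walk e k x y) (iota 0 #|T|).

Definition connected (T : finType) (e : rel T) : Prop :=
  forall x y : T, connect e x y.

(** Meaningful for connected graphs only, because of the default value of
    [dist]. *)
Definition diameter (T : finType) (e : rel T) : nat :=
  \max_(x : T) \max_(y : T) dist e x y.

Definition configuration (T : finType) := {ffun T -> nat}.

(** The conditions force [u != v], since [dist e u u = 0 < C u]. *)
Definition cup_move (T : finType) (e : rel T) (C C' : configuration T) : Prop :=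
  exists u v : T,
    [/\ 0 < C u, 0 < C v, dist e u v = C u
      & C' = [ffun x => if x == u then 0
                        else if x == v then C u + C v else C x]].

Definition one_cup_each (T : finType) : configuration T := [ffun => 1].

Definition all_cups_on (T : finType) (r : T) : configuration T :=
  [ffun x => if x == r then #|T| else 0].

Definition stackable (T : finType) (e : rel T) (r : T) : Prop :=
  clos_refl_trans _ (cup_move e) (one_cup_each T) (all_cups_on r).

(** Algorithms are programs for a random access machine in the style of Cook and
    Reckhow, except that registers [X_0, X_1, ...] hold natural numbers and the
    input is a read-only array of numbers.  Time is the number of instructions
    executed.  The arithmetic is limited to addition and subtraction, so that in
    [t] steps numbers gain at most [O(t)] bits and polynomial time agrees with
    polynomial time on Turing machines; a unit-cost multiplication would break
    this. *)
Inductive instruction : Type :=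
  | Const (i c : nat)    (* X_i := c *)
  | Add (i j k : nat)    (* X_i := X_j + X_k *)
  | Sub (i j k : nat)    (* X_i := X_j - X_k, truncated at 0 *)
  | Fetch (i j : nat)    (* X_i := X_(X_j) *)
  | Store (i j : nat)    (* X_(X_i) := X_j *)
  | Input (i j : nat)    (* X_i := input cell number X_j *)
  | Jump (j l : nat).    (* continue at instruction l if X_j > 0 *)

Definition program := seq instruction.

Record state := State { counter : nat; register : nat -> nat }.

Definition initial_state : state := State 0 (fun=> 0).

Definition set_register (X : nat -> nat) (i a : nat) : nat -> nat :=
  fun j => if j == i then a else X j.

(** Input cells beyond the end of the input read as [0]. *)
Definition execute (w : seq nat) (ins : instruction) (s : state) : state :=
  let: State pc X := s in
  match ins with
  | Const i c => State pc.+1 (set_register X i c)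
  | Add i j k => State pc.+1 (set_register X i (X j + X k))
  | Sub i j k => State pc.+1 (set_register X i (X j - X k))
  | Fetch i j => State pc.+1 (set_register X i (X (X j)))
  | Store i j => State pc.+1 (set_register X (X i) (X j))
  | Input i j => State pc.+1 (set_register X i (nth 0 w (X j)))
  | Jump j l => State (if 0 < X j then l else pc.+1) X
  end.

(** The machine halts when the program counter leaves the program. *)
Definition halted (P : program) (s : state) : bool := size P <= counter s.

Definition step (P : program) (w : seq nat) (s : state) : state :=
  if onth P (counter s) is Some ins then execute w ins s else s.

(** On input [w], the program halts after at most [t] steps, and its answer,
    positive when [X_0] is nonzero and negative otherwise, is the truth value of
    [A]. *)
Definition decides_within (P : program) (w : seq nat) (t : nat) (A : Prop) :
    Prop :=
  let s := iter t (step P w) initial_state in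
  halted P s /\ (register s 0 != 0 <-> A).

(** The number of vertices, the number of the vertex [r], and the adjacency
    matrix row by row, vertices being numbered from [0] in the order of
    [enum T].  For [T = 'I_n] that numbering is the identity, so every labelled
    graph occurs as an input. *)
Definition encode (T : finType) (e : rel T) (r : T) : seq nat :=
  #|T| :: nat_of_ord (enum_rank r) ::
    [seq nat_of_bool (e x y) | x <- enum T, y <- enum T].

(* Main.v *)
From Stdlib Require Import Relation_Operators.
Require Import Defs.
From mathcomp Require Import all_boot zify.

Set Implicit Arguments.
Unset Strict Implicit.
Unset Printing Implicit Defensive.

(** A vertex other than [r] that holds three cups is stuck for ever, and in
    diameter two a vertex holding two cups can only usefully jump to [r].  Hence
    [G] is [r]-stackable iff [G - r] has a matching covering all vertices at
    distance two from [r]: a neighbour of [r] sends its cup straight to [r], and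
    a vertex at distance two has to receive the cup of its partner or to give it
    its own.

    Such a matching is sought by augmentation.  Given a matching that covers all
    of [Y] but [q], grow a set [D] containing [q], with for every [u] in [D] a
    matching that misses [u] instead of [q].  If this gets stuck, the
    neighbourhood of [D] is smaller than [D], so [Y] cannot be covered.  If two
    vertices [u, v] of [D] are adjacent, the symmetric difference of their
    matchings contains a path from [u] to [v], which closes up to an odd cycle;
    contracting it to [u] preserves the existence of a matching covering [Y].
    Instead of lifting an augmentation through the contractions, edges outside
    the current matching are deleted as long as the test remains positive; the
    edges that survive lie in every matching covering [Y], and adding them to the
    current one yields the matching sought.

    The algorithm is written in a language of first-order definable updates of
    ternary relations on the vertex set and of loops over the vertices; every
    program of this language runs in polynomial time. *)

(** * Program fragments *)

(** Jump targets are absolute, so code depends on the address at which it is loaded. *)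
Definition code := nat -> program.

Definition ins (i : instruction) : code := fun=> [:: i].

Definition cseq (a b : code) : code := fun o => a o ++ b (o + size (a o)).

(** Relies on register 1 holding the number of rounds and register 2 holding 1. The test follows the
    body, so the number of rounds has to be positive. *)
Definition loop (v t : nat) (c : code) : code :=
  fun o => Const v 0 :: c o.+1 ++ [:: Add v v 2; Defs.Sub t 1 v; Jump t o.+1].

Definition skip_if (d : nat) (c : code) : code :=
  fun o => Jump d (o.+1 + size (c o.+1)) :: c o.+1.

Notation "a ;; b" := (cseq a b) (at level 60, right associativity).

Section Exec.
Variable w : seq nat.

(** A Hoare triple with a time bound. Quantifying over the surrounding program is what makes triples
    compose. *)
Definition does (c : code) (X : nat -> nat) (b : nat)
    (Post : (nat -> nat) -> Prop) : Prop :=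
  forall pre post, exists t X', [/\ t <= b,
    iter t (step (pre ++ c (size pre) ++ post) w) (State (size pre) X) =
      State (size pre + size (c (size pre))) X' & Post X'].

Lemma does_weaken c X b b' (P P' : (nat -> nat) -> Prop) :
  b <= b' -> (forall X', P X' -> P' X') -> does c X b P -> does c X b' P'.
Proof.
move=> bb' PP' H pre post; have [t [X' [tb eqt PX']]] := H pre post.
by exists t, X'; split; [apply: leq_trans bb' | | apply: PP'].
Qed.

Lemma does_seq c1 c2 X b1 b2 (P Q : (nat -> nat) -> Prop) :
  does c1 X b1 P -> (forall X', P X' -> does c2 X' b2 Q) ->
  does (c1 ;; c2) X (b1 + b2) Q.
Proof.
move=> H1 H2 pre post; rewrite /cseq.
set a := c1 _; set a' := c2 _.
have [t1 [X1 [tb1 eq1 P1]]] := H1 pre (a' ++ post).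
have [t2 [X2 [tb2 eq2 P2]]] := H2 _ P1 (pre ++ a) post.
exists (t2 + t1), X2; split=> //; first by rewrite addnC leq_add.
rewrite iterD -!catA eq1.
by move: eq2; rewrite size_cat -!catA size_cat addnA.
Qed.

Lemma step_at pre i post X :
  step (pre ++ i :: post) w (State (size pre) X) =
  execute w i (State (size pre) X).
Proof. by rewrite /step /= onth_cat ltnn subnn. Qed.

Lemma step_eq P pre i post pc X :
  P = pre ++ i :: post -> pc = size pre ->
  step P w (State pc X) = execute w i (State pc X).
Proof. by move=> -> ->; apply: step_at. Qed.

Lemma does_ins i X X' (P : (nat -> nat) -> Prop) :
  (forall pc, execute w i (State pc X) = State pc.+1 X') -> P X' ->
  does (ins i) X 1 P.
Proof.
by move=> ei PX' pre post; exists 1, X'; split=> //=; rewrite step_at ei addn1.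
Qed.

Definition effect (i : instruction) (X : nat -> nat) : nat -> nat :=
  register (execute w i (State 0 X)).

Definition is_jump (i : instruction) : bool :=
  if i is Jump _ _ then true else false.

Lemma does_step i X (P : (nat -> nat) -> Prop) :
  ~~ is_jump i -> P (effect i X) -> does (ins i) X 1 P.
Proof. by case: i => // *; apply: does_ins; last by eassumption. Qed.

Lemma does_step_seq i c X b (P : (nat -> nat) -> Prop) :
  ~~ is_jump i -> does c (effect i X) b P -> does (ins i ;; c) X b.+1 P.
Proof.
move=> ji H; rewrite -add1n; apply: (does_seq (P := eq (effect i X))).
  exact: does_step.
by move=> _ <-.
Qed.

(** [Inv k] describes the registers when round [k] starts, with [v] and [t] already updated by the
    tail, which costs three steps per round. *)
Lemma does_loop_raw v t c X b n (Inv : nat -> (nat -> nat) -> Prop) :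
  0 < n -> v != t -> v != 1 ->
  Inv 0 (set_register X v 0) ->
  (forall k Y, k < n -> Inv k Y -> does c Y b (fun Y' =>
     [/\ Y' 1 = n, Y' 2 = 1, Y' v = k &
       Inv k.+1 (set_register (set_register Y' v k.+1) t (n - k.+1))])) ->
  does (loop v t c) X (n * (b + 3)).+1 (Inv n).
Proof.
move=> n0 vt v1 I0 IH pre post; rewrite /loop.
set body := c _.
pose tail := [:: Add v v 2; Defs.Sub t 1 v; Jump t (size pre).+1].
pose P := pre ++ (Const v 0 :: body ++ tail) ++ post.
have size_c : size (Const v 0 :: body ++ tail) = (size body + 4).
  by rewrite /= size_cat /=; lia.
have round k Y : k < n -> Inv k Y -> exists t' Y', [/\ t' <= b + 3,
    iter t' (step P w) (State (size pre).+1 Y) =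
      State (if k.+1 < n then (size pre).+1 else size pre + (size body + 4)) Y'
    & Inv k.+1 Y'].
  move=> kn Ik.
  have [t' [Y' [tb eqt [Y1 Y2 Yv Ik1]]]] :=
    IH k Y kn Ik (rcons pre (Const v 0)) (tail ++ post).
  move: eqt; rewrite !size_rcons cat_rcons -/body => eqt.
  have -> : P = pre ++ Const v 0 :: body ++ tail ++ post.
    by rewrite /P /= -catA.
  exists (3 + t'), (set_register (set_register Y' v k.+1) t (n - k.+1)).
  split=> //; first by lia.
  rewrite iterD eqt /=.
  pose q := pre ++ Const v 0 :: body.
  have sq : size q = (size pre).+1 + size body by rewrite size_cat /=; lia.
  have -> : pre ++ Const v 0 :: body ++ tail ++ post = q ++ tail ++ post.
    by rewrite /q -catA.
  rewrite -sq step_at /= Yv Y2 addn1.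
  rewrite (@step_eq _ (rcons q (Add v v 2)) (Defs.Sub t 1 v)
    (Jump t (size pre).+1 :: post)) ?size_rcons ?cat_rcons //=.
  rewrite (@step_eq _ (rcons (rcons q (Add v v 2)) (Defs.Sub t 1 v))
    (Jump t (size pre).+1) post) ?size_rcons ?cat_rcons //=.
  rewrite /set_register !eqxx [1 == v]eq_sym (negPf v1) Y1 subn_gt0.
  by congr (State _ _); case: ifP => // _; rewrite sq; lia.
have run_from k Y : k < n -> Inv k Y -> exists t' Y', [/\ t' <= (n - k) * (b + 3),
    iter t' (step P w) (State (size pre).+1 Y) =
      State (size pre + (size body + 4)) Y' & Inv n Y'].
  move: {2}(n - k) (leqnn (n - k)) => m; elim: m k Y => [|m IHm] k Y nk kn Ik.
    by lia.
  have [t1 [Y1 [tb1 eq1 I1]]] := round k Y kn Ik.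
  move: eq1; case: ltnP => kn1 eq1; last first.
    have E : k.+1 = n by lia.
    exists t1, Y1; split=> //; last by rewrite -E.
    have -> : n - k = 1 by lia.
    by rewrite mul1n.
  have [|t2 [Y2 [tb2 eq2 I2]]] := IHm k.+1 Y1 _ kn1 I1; first by lia.
  exists (t2 + t1), Y2; split=> //; last by rewrite iterD eq1.
  have -> : n - k = (n - k.+1).+1 by lia.
  by rewrite mulSn addnC leq_add.
have [t' [Y' [tb eqt I']]] := run_from 0 _ n0 I0.
rewrite size_c -/tail -/P.
exists (t' + 1), Y'; split=> //; first by rewrite subn0 in tb; lia.
by rewrite iterD /= step_at /=.
Qed.

Lemma does_loop v t c X b n (Inv : nat -> (nat -> nat) -> Prop) :
  0 < n -> v != t -> v != 1 ->
  Inv 0 (set_register X v 0) ->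
  (forall k Y, k < n -> Y v = k -> Inv k Y -> does c Y b (fun Y' =>
     [/\ Y' 1 = n, Y' 2 = 1, Y' v = k &
       Inv k.+1 (set_register (set_register Y' v k.+1) t (n - k.+1))])) ->
  does (loop v t c) X (n * (b + 3)).+1 (Inv n).
Proof.
move=> n0 vt v1 I0 IH.
apply: (does_weaken (b := (n * (b + 3)).+1)
  (P := fun Y => Y v = n /\ Inv n Y)) => //; first by move=> Y [].
apply: (does_loop_raw (Inv := fun k Y => Y v = k /\ Inv k Y)) => //.
- by split=> //; rewrite /set_register eqxx.
move=> k Y kn [Yv Ik]; apply: does_weaken (IH k Y kn Yv Ik) => //.
by move=> Y' [Y1 Y2 Yk I1]; split=> //; split=> //; rewrite /set_register (negPf vt) eqxx.
Qed.

Lemma does_skip_if d c X b (P : (nat -> nat) -> Prop) :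
  (0 < X d -> P X) -> (X d = 0 -> does c X b P) ->
  does (skip_if d c) X b.+1 P.
Proof.
move=> H1 H2 pre post; rewrite /skip_if.
have [d0|d0] := posnP (X d); last first.
  exists 1, X; split=> //=; last exact: H1.
  by rewrite step_at /= d0; congr State; lia.
have [t [X' [tb eqt PX']]] := H2 d0 (rcons pre (Jump d ((size pre).+1 +
   size (c (size pre).+1)))) post.
exists (t + 1), X'; split=> //; first by lia.
move: eqt; rewrite !size_rcons cat_rcons => eqt.
by rewrite iterD /= step_at /= d0 /= eqt; congr State; lia.
Qed.

End Exec.

(** * The relational language and its compilation *)

Inductive form :=
  | Edge of nat & nat
  | Eq of nat & nat
  | Rel of nat & nat & nat & nat
  | Neg of form
  | And of form & form
  | Or of form & form
  | Ex of nat & form.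

Inductive cmd :=
  | Put of nat & nat & nat & nat & form
  | Seq of cmd & cmd
  | When of form & cmd
  | For of nat & cmd.

Definition upd (A : Type) (f : nat -> A) (i : nat) (a : A) : nat -> A :=
  fun j => if j == i then a else f j.

Definition rels (T : Type) := nat -> T -> T -> T -> bool.

Section Semantics.
Variables (T : finType) (e : rel T).

Fixpoint holds (s : rels T) (p : nat -> T) (f : form) : bool :=
  match f with
  | Edge i j => e (p i) (p j)
  | Eq i j => p i == p j
  | Rel k i j l => s k (p i) (p j) (p l)
  | Neg f => ~~ holds s p f
  | And f g => holds s p f && holds s p g
  | Or f g => holds s p f || holds s p g
  | Ex i f => [exists x, holds s (upd p i x) f]
  end.

Fixpoint run (c : cmd) (p : nat -> T) (s : rels T) : rels T :=
  match c with
  | Put k i j l f => upd s k (fun x y z =>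
      if [&& x == p i, y == p j & z == p l] then holds s p f else s k x y z)
  | Seq c d => run d p (run c p s)
  | When f c => if holds s p f then run c p s else s
  | For i c => foldl (fun s x => run c (upd p i x) s) s (enum T)
  end.

End Semantics.

(** The machine cannot multiply, so the product with the number of vertices is a loop of
    additions. *)
Definition mul_n (d : nat) : code :=
  ins (Const d.+1 0) ;; loop d.+2 d.+3 (ins (Add d.+1 d.+1 d)) ;;
  ins (Add d d.+1 0).

Definition horner (d r : nat) : code := mul_n d ;; ins (Add d d r).

Section Compile.
Variable B : nat.

(** Cells are numbered in base [n] from register [B] on. The relation number is the leading digit,
    so it need not be below [n]. Registers below [B] remain work space. *)
Definition address (d k i j l : nat) : code :=
  ins (Const d k) ;; horner d i ;; horner d j ;; horner d l ;;
  ins (Const d.+1 B) ;; ins (Add d d d.+1).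

(** The truth value ends up in [d], the first free register, and [r] tells where each variable
    lives. Register 2 holds 1, so [Sub d 2 d] negates, and doing it twice turns any positive count
    into 1. The 2 added in [Edge] skips the header of the input. *)
Fixpoint eval (r : nat -> nat) (d : nat) (f : form) : code :=
  match f with
  | Edge i j => ins (Add d (r i) 0) ;; horner d (r j) ;;
      ins (Const d.+1 2) ;; ins (Add d d d.+1) ;; ins (Input d d)
  | Eq i j => ins (Defs.Sub d (r i) (r j)) ;; ins (Defs.Sub d.+1 (r j) (r i)) ;;
      ins (Add d d d.+1) ;; ins (Defs.Sub d 2 d)
  | Rel k i j l => address d k (r i) (r j) (r l) ;; ins (Fetch d d)
  | Neg f => eval r d f ;; ins (Defs.Sub d 2 d)
  | And f g => eval r d f ;; eval r d.+1 g ;; ins (Add d d d.+1) ;;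
      ins (Defs.Sub d d 2)
  | Or f g => eval r d f ;; eval r d.+1 g ;; ins (Add d d d.+1) ;;
      ins (Defs.Sub d 2 d) ;; ins (Defs.Sub d 2 d)
  | Ex i f => ins (Const d 0) ;;
      loop d.+1 d.+2 (eval (upd r i d.+1) d.+2 f ;; ins (Add d d d.+2)) ;;
      ins (Defs.Sub d 2 d) ;; ins (Defs.Sub d 2 d)
  end.

(** The least value 4 is the number of registers in which [mul_n] works. *)
Fixpoint eval_space (f : form) : nat :=
  match f with
  | Edge _ _ | Eq _ _ | Rel _ _ _ _ => 4
  | Neg f => eval_space f
  | And f g | Or f g => maxn (eval_space f) (eval_space g).+1
  | Ex i f => (eval_space f).+2
  end.

Fixpoint eval_time (f : form) (n : nat) : nat :=
  match f with
  | Edge _ _ => n * 4 + 8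
  | Eq _ _ => 4
  | Rel _ _ _ _ => n * 12 + 16
  | Neg f => eval_time f n + 1
  | And f g => eval_time f n + eval_time g n + 2
  | Or f g => eval_time f n + eval_time g n + 3
  | Ex i f => n * (eval_time f n + 4) + 4
  end.

Fixpoint compile (r : nat -> nat) (d : nat) (c : cmd) : code :=
  match c with
  | Put k i j l f => eval r d f ;; address d.+1 k (r i) (r j) (r l) ;;
      ins (Store d.+1 d)
  | Seq a b => compile r d a ;; compile r d b
  | When f c => eval r d f ;; ins (Defs.Sub d 2 d) ;; skip_if d (compile r d c)
  | For i c => loop d d.+1 (compile (upd r i d) d.+1 c)
  end.

Fixpoint space (c : cmd) : nat :=
  match c with
  | Put _ _ _ _ f => (eval_space f).+4
  | Seq a b => maxn (space a) (space b)
  | When f c => maxn (eval_space f) (space c)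
  | For _ c => (space c).+2
  end.

Fixpoint time (c : cmd) (n : nat) : nat :=
  match c with
  | Put _ _ _ _ f => eval_time f n + n * 12 + 16
  | Seq a b => time a n + time b n
  | When f c => eval_time f n + time c n + 2
  | For _ c => (n * (time c n + 3)).+1
  end.

End Compile.

(** * Correctness and running time of compiled code *)

Definition cell (B n k x y z : nat) : nat := ((k * n + x) * n + y) * n + z + B.

Lemma eval_space_ge f : 4 <= eval_space f.
Proof. by elim: f => //=; lia. Qed.

Lemma cell_inj B n k x y z k' x' y' z' :
  x < n -> y < n -> z < n -> x' < n -> y' < n -> z' < n ->
  cell B n k x y z = cell B n k' x' y' z' ->
  [/\ k = k', x = x', y = y' & z = z'].
Proof.
move=> xn yn zn xn' yn' zn' /addIn.
have digit a b a' b' : b < n -> b' < n -> a * n + b = a' * n + b' ->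
    a = a' /\ b = b'.
  move=> bn bn' E; have n0 : 0 < n by lia.
  have Ea := congr1 (divn^~ n) E; have Eb := congr1 (modn^~ n) E.
  by rewrite !divnMDl // !divn_small // !addn0 in Ea; rewrite !modnMDl !modn_small in Eb.
by move=> /digit[]// /digit[]// /digit[]//.
Qed.

Definition frame (lo hi : nat) (X X' : nat -> nat) : Prop :=
  forall j, (j < lo) || (hi <= j) -> X' j = X j.

(* Register 1 holds [#|T|], register 3 the root; registers 0 and 2 serve as
   constants. *)
Definition tuned (n : nat) (X : nat -> nat) : Prop :=
  [/\ X 0 = 0, X 1 = n & X 2 = 1].

Ltac lookup := rewrite /effect /= /set_register /=;
  repeat match goal with |- context [if ?b then _ else _] =>
    case: (boolP b) => ? //=; try lia end.

Lemma frame_tuned lo hi n X X' :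
  2 < lo -> frame lo hi X X' -> tuned n X -> tuned n X'.
Proof. by move=> lo2 fr [X0 X1 X2]; split; rewrite fr //; lia. Qed.

Section Correct.
Variables (w : seq nat) (n : nat).
Hypothesis n0 : 0 < n.

Lemma does_mul_n d X : tuned n X -> 2 < d ->
  does w (mul_n d) X (n * 4 + 3)
    (fun X' => X' d = X d * n /\ frame d (d + 4) X X').
Proof.
move=> [X0 X1 X2] d2.
pose Inv k (Y : nat -> nat) := Y d.+1 = k * X d /\
  (forall j : nat, j != d.+1 -> j != d.+2 -> j != d.+3 -> Y j = X j).
have -> : n * 4 + 3 = ((n * (1 + 3)).+1 + 1).+1 by lia.
apply: does_step_seq => //; apply: (does_seq (P := Inv n)).
  apply: does_loop => //; try lia.
  - by split=> [|j *]; lookup.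
  - move=> k Y kn Yk [Yd Yo]; apply: does_step => //.
    rewrite /effect /= /set_register /=.
    split; try (by lookup; rewrite Yo; lia).
    split=> [|j *]; lookup; last by rewrite Yo.
    by rewrite Yd (Yo d) ?mulSn; lia.
move=> Y [Yd Yo]; apply: does_step => //; split=> [|j *]; last first.
  by lookup; rewrite Yo; lia.
by lookup; rewrite Yd Yo; lia.
Qed.

Lemma does_horner d r X : tuned n X -> 2 < d -> r < d ->
  does w (horner d r) X (n * 4 + 4)
    (fun X' => X' d = X d * n + X r /\ frame d (d + 4) X X').
Proof.
move=> tX d2 rd; have -> : n * 4 + 4 = n * 4 + 3 + 1 by lia.
apply: (does_seq (does_mul_n tX d2)) => Y [Yd Yf].
apply: does_step => //; split=> [|j jP]; lookup; last by rewrite Yf.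
by rewrite Yd (Yf r) //; lia.
Qed.

Lemma does_address B d k i j l X :
  tuned n X -> 2 < d -> i < d -> j < d -> l < d ->
  does w (address B d k i j l) X (n * 12 + 15)
    (fun X' => X' d = cell B n k (X i) (X j) (X l) /\ frame d (d + 4) X X').
Proof.
move=> tX d2 id jd ld; have -> : n * 12 + 15 =
   (n * 4 + 4 + (n * 4 + 4 + (n * 4 + 4 + 2))).+1 by lia.
apply: does_step_seq => //; set X0 := effect _ _ _.
have f0 : frame d (d + 4) X X0 by move=> m mP; rewrite /X0; lookup.
have X0d : X0 d = k by rewrite /X0; lookup.
have t0 := frame_tuned d2 f0 tX.
apply: (does_seq (does_horner t0 d2 id)) => X1 [X1d f1].
have t1 := frame_tuned d2 f1 t0.
apply: (does_seq (does_horner t1 d2 jd)) => X2 [X2d f2].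
have t2 := frame_tuned d2 f2 t1.
apply: (does_seq (does_horner t2 d2 ld)) => X3 [X3d f3].
apply: does_step_seq => //; apply: does_step => //.
split=> [|m mP]; lookup; last by rewrite f3 ?f2 ?f1 ?f0.
rewrite X3d X2d X1d X0d (f2 l) ?(f1 l) ?(f1 j) ?f0 //; try lia.
Qed.

End Correct.

Lemma nth_allpairs (S1 S2 R : Type) (f : S1 -> S2 -> R) a b c s t i j :
  i < size s -> j < size t ->
  nth c [seq f x y | x <- s, y <- t] (i * size t + j) =
  f (nth a s i) (nth b t j).
Proof.
elim: s i => [|x s IHs] [|i] //= is_ jt.
  by rewrite mul0n nth_cat size_map jt (nth_map b).
rewrite nth_cat size_map mulSn -addnA ltnNge leq_addr /= addKn.
exact: IHs.
Qed.

Lemma nth_encode (T : finType) (e : rel T) (r x y : T) :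
  nth 0 (encode e r) (enum_rank x * #|T| + enum_rank y + 2) = e x y.
Proof.
rewrite addn2 /=; have sT : #|T| = size (enum T) by rewrite cardE.
have -> : enum_rank x * #|T| = enum_rank x * size (enum T) by rewrite {2}sT.
by rewrite (nth_allpairs _ x x) ?nth_enum_rank // -sT.
Qed.

Section Run.
Variables (T : finType) (e : rel T) (o : T) (B : nat).
Let w := encode e o.
Let n := #|T|.

Let n0 : 0 < n. Proof. by apply/card_gt0P; exists o. Qed.

Definition stored (s : rels T) (X : nat -> nat) : Prop := forall k x y z,
  X (cell B n k (enum_rank x) (enum_rank y) (enum_rank z)) = s k x y z.

Definition bound (r : nat -> nat) (p : nat -> T) (d : nat) (X : nat -> nat) :=
  forall i, r i < d /\ X (r i) = enum_rank (p i).

Lemma frame_stored d s X X' : frame d B X X' -> stored s X -> stored s X'.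
Proof. by move=> fr st k x y z; rewrite fr ?st // /cell leq_addl orbT. Qed.

Lemma frame_bound d hi r p X X' :
  frame d hi X X' -> bound r p d X -> bound r p d X'.
Proof. by move=> fr b i; have [rd rX] := b i; split; rewrite ?fr ?rd. Qed.

Lemma bound_weaken d d' r p X : d <= d' -> bound r p d X -> bound r p d' X.
Proof. by move=> dd b i; have [rd rX] := b i; split=> //; lia. Qed.

(** Only the work space between [d] and [B] changes: variables live below it and relations above it,
    so subformulas evaluated later still find both intact. *)
Lemma does_eval f r p d s X :
  tuned n X -> 2 < d -> d + eval_space f <= B -> bound r p d X -> stored s X ->
  does w (eval B r d f) X (eval_time f n)
    (fun X' => X' d = holds e s p f /\ frame d B X X').
Proof.
elim: f r p d X => [i j|i j|k i j l|f IHf|f IHf g IHg|f IHf g IHg|i f IHf]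
  r p d X tX d2 /= dB bX sX.
- have -> : n * 4 + 8 = (n * 4 + 4 + 3).+1 by lia.
  have [[ri Xi] [rj Xj]] := (bX i, bX j).
  have [X0 _ _] := tX.
  apply: does_step_seq => //; set Y := effect _ _ _.
  have Yd : Y d = enum_rank (p i) by rewrite /Y; lookup; rewrite Xi X0 addn0.
  have Yf : frame d B X Y by move=> m mP; rewrite /Y; lookup.
  have tY := frame_tuned d2 Yf tX.
  apply: (does_seq (does_horner _ n0 tY d2 rj)) => Z [Zd Zf].
  do 2![apply: does_step_seq => //]; apply: does_step => //.
  split=> [|m mP]; lookup; last by rewrite Zf ?Yf //; lia.
  by rewrite Zd Yd Yf ?rj // Xj nth_encode.
- have [[ri Xi] [rj Xj]] := (bX i, bX j).
  have [_ _ X2] := tX.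
  do 3![apply: does_step_seq => //]; apply: does_step => //.
  split=> [|m mP]; lookup; rewrite X2 Xi Xj.
  by rewrite -(inj_eq enum_rank_inj) -val_eqE /=; lia.
- have -> : n * 12 + 16 = n * 12 + 15 + 1 by lia.
  have [[[ri Xi] [rj Xj]] [rl Xl]] := (bX i, bX j, bX l).
  apply: (does_seq (does_address _ n0 B k tX d2 ri rj rl)) => Y [Yd Yf].
  apply: does_step => //; split=> [|m mP]; lookup; last by rewrite Yf //; lia.
  by rewrite Yd Yf ?Xi ?Xj ?Xl ?sX // /cell; lia.
- have f4 := eval_space_ge f.
  apply: (does_seq (IHf _ _ _ _ tX d2 dB bX sX)) => Y [Yd Yf].
  have [_ _ Y2] := frame_tuned d2 Yf tX.
  apply: does_step => //; split=> [|m mP]; lookup; by rewrite Yf //; lia.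
- have [f4 g4] := (eval_space_ge f, eval_space_ge g).
  rewrite -addnA; apply: (does_seq (IHf _ _ _ _ tX d2 _ bX sX)) => [|Y [Yd Yf]].
    by lia.
  have tY := frame_tuned d2 Yf tX.
  have bY := bound_weaken (leqnSn d) (frame_bound Yf bX).
  have sY := frame_stored Yf sX.
  apply: (does_seq (IHg _ _ _ _ tY _ _ bY sY)) => [||Z [Zd Zf]]; try by lia.
  have [_ _ Z2] := frame_tuned (leqW d2) Zf tY.
  apply: does_step_seq => //; apply: does_step => //.
  split=> [|m mP]; lookup; last by rewrite Zf ?Yf //; lia.
  by rewrite Zd (Zf d) ?ltnSn // Yd Z2; case: (holds e s p f); case: (holds e s p g).
- have [f4 g4] := (eval_space_ge f, eval_space_ge g).
  rewrite -addnA; apply: (does_seq (IHf _ _ _ _ tX d2 _ bX sX)) => [|Y [Yd Yf]].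
    by lia.
  have tY := frame_tuned d2 Yf tX.
  have bY := bound_weaken (leqnSn d) (frame_bound Yf bX).
  have sY := frame_stored Yf sX.
  apply: (does_seq (IHg _ _ _ _ tY _ _ bY sY)) => [||Z [Zd Zf]]; try by lia.
  have [_ _ Z2] := frame_tuned (leqW d2) Zf tY.
  do 2![apply: does_step_seq => //]; apply: does_step => //.
  split=> [|m mP]; lookup; last by rewrite Zf ?Yf //; lia.
  by rewrite Zd (Zf d) ?ltnSn // Yd Z2; case: (holds e s p f); case: (holds e s p g).
have f4 := eval_space_ge f.
have -> : n * (eval_time f n + 4) + 4 =
  ((n * (eval_time f n + 1 + 3)).+1 + 2).+1 by lia.
apply: does_step_seq => //.
pose Inv k (Y : nat -> nat) :=
  Y d = count (fun x => holds e s (upd p i x) f) (take k (enum T)) /\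
  frame d B X Y.
apply: (does_seq (P := Inv n)).
  apply: does_loop => //; try lia.
    by split=> [|m mP]; lookup; rewrite take0.
  move=> k Y kn Yk [Yd Yf].
  have kT : k < size (enum T) by rewrite -cardE.
  (* The loop counter is the rank of the vertex being tried, so its register can serve as the
     register of the bound variable. *)
  pose x := nth o (enum T) k.
  have xk : enum_rank x = k :> nat.
    by rewrite /x -[k]/(nat_of_ord (Ordinal kn)) -enum_val_nth enum_valK.
  have tY := frame_tuned d2 Yf tX.
  have sY := frame_stored Yf sX.
  have bY : bound (upd r i d.+1) (upd p i x) d.+2 Y.
    move=> j; rewrite /upd; case: eqP => _; first by rewrite ltnSn Yk xk.
    have [rj rX] := bX j; split; first by lia.
    by rewrite Yf ?rj.
  apply: (does_seq (IHf _ _ _ _ tY _ _ bY sY)) => [||Z [Zd Zf]]; try lia.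
  have [_ Z1 Z2] := frame_tuned (leqW (leqW d2)) Zf tY.
  apply: does_step => //; split; try (by lookup; rewrite Zf //; lia).
  split=> [|m mP]; lookup; last by rewrite Zf ?Yf //; lia.
  rewrite Zd Zf ?Yd //; last by lia.
  by rewrite (take_nth o kT) -cats1 count_cat /= addn0.
move=> Y [Yd Yf]; have [_ _ Y2] := frame_tuned d2 Yf tX.
apply: does_step_seq => //; apply: does_step => //.
split=> [|m mP]; lookup; last by rewrite Yf //; lia.
rewrite Yd Y2 take_oversize; last by rewrite -cardE.
have -> : [exists x, holds e s (upd p i x) f] =
    has (fun x => holds e s (upd p i x) f) (enum T).
  by apply/existsP/hasP => [[x xP]|[x _ xP]]; exists x => //; rewrite mem_enum.
by rewrite has_count; case: count.
Qed.

Lemma does_compile c r p d s X :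
  tuned n X -> 2 < d -> d + space c <= B -> bound r p d X -> stored s X ->
  does w (compile B r d c) X (time c n) (fun X' =>
    (forall j, j < d -> X' j = X j) /\ stored (run e c p s) X').
Proof.
elim: c r p d s X => [k i j l f|a IHa b IHb|f c IHc|i c IHc]
  r p d s X tX d2 /= dB bX sX.
- have f4 := eval_space_ge f.
  have -> : eval_time f n + n * 12 + 16 = eval_time f n + (n * 12 + 15 + 1).
    by lia.
  apply: (does_seq (does_eval tX d2 _ bX sX)) => [|Y [Yd Yf]]; first by lia.
  have tY := frame_tuned d2 Yf tX.
  have sY := frame_stored Yf sX.
  have bY := bound_weaken (leqnSn d) (frame_bound Yf bX).
  have [[[ri Yi] [rj Yj]] [rl Yl]] := (bY i, bY j, bY l).
  apply: (does_seq (does_address _ n0 B k tY (leqW d2) ri rj rl)) => Z [Zd Zf].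
  have Zd1 : Z d.+1 =
      cell B n k (enum_rank (p i)) (enum_rank (p j)) (enum_rank (p l)).
    by rewrite Zd Yi Yj Yl.
  have ZB m : B <= m -> Z m = Y m by move=> Bm; rewrite Zf //; lia.
  have ge_cell k' x y z : B <= cell B n k' x y z by apply: leq_addl.
  apply: does_step => //; rewrite /effect /= Zd1; split=> [m md|k' x y z].
    rewrite /set_register ifN; first by rewrite Zf ?Yf ?md //; lia.
    by apply/eqP => mC; have := ge_cell k (enum_rank (p i)) (enum_rank (p j))
      (enum_rank (p l)); rewrite -mC; lia.
  rewrite /set_register /upd; case: eqP => [C|neq].
    have [-> /val_inj/enum_rank_inj-> /val_inj/enum_rank_inj->] :=
      cell_inj (ltn_ord _) (ltn_ord _) (ltn_ord _) (ltn_ord _) (ltn_ord _)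
        (ltn_ord _) C.
    move=> /val_inj/enum_rank_inj->; rewrite !eqxx Zf ?Yd //.
    by rewrite ltnSn.
  rewrite ZB // sY; case: eqP => // kk; case: ifP => [|_]; last by rewrite kk.
  by case/and3P=> /eqP xi /eqP yj /eqP zl; case: neq; rewrite kk xi yj zl.
- apply: (does_seq (IHa _ _ _ _ _ tX d2 _ bX sX)) => [|Y [Yl sY]]; first by lia.
  have tY : tuned n Y by case: tX => X0 X1 X2; split; rewrite Yl //; lia.
  have bY : bound r p d Y.
    by move=> i; have [ri Xi] := bX i; split; rewrite ?Yl.
  apply: (does_weaken (leqnn _) _ (IHb _ _ _ _ _ tY d2 _ bY sY)) => [Z [Zl sZ]|].
    by split=> // j jd; rewrite Zl ?Yl.
  by lia.
- have f4 := eval_space_ge f.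
  have -> : eval_time f n + time c n + 2 = eval_time f n + (time c n).+2 by lia.
  apply: (does_seq (does_eval tX d2 _ bX sX)) => [|Y [Yd Yf]]; first by lia.
  have tY := frame_tuned d2 Yf tX; have [_ _ Y2] := tY.
  apply: does_step_seq => //; set Z := effect _ _ _.
  have Zf : frame d B X Z by move=> m mP; rewrite /Z; lookup; rewrite Yf.
  have Zd : Z d = ~~ holds e s p f.
    by rewrite /Z; lookup; rewrite Yd Y2; case: holds.
  have tZ := frame_tuned d2 Zf tX.
  apply: does_skip_if; rewrite Zd; case: ifP => //= fP _.
    by split; [move=> j jd; rewrite Zf ?jd | apply: frame_stored Zf sX].
  have [bZ sZ] := (frame_bound Zf bX, frame_stored Zf sX).
  apply: (does_weaken (leqnn _) _ (IHc _ _ _ _ _ tZ d2 _ bZ sZ)) => [W [Wl sW]|].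
    by split=> // j jd; rewrite Wl ?Zf ?jd.
  by lia.
pose Inv k (Y : nat -> nat) := (forall j, j < d -> Y j = X j) /\
  stored (foldl (fun s x => run e c (upd p i x) s) s (take k (enum T))) Y.
have -> : foldl (fun s x => run e c (upd p i x) s) s (enum T) =
    foldl (fun s x => run e c (upd p i x) s) s (take n (enum T)).
  by rewrite take_oversize // -cardE.
apply: (does_loop (Inv := Inv)) => //; try lia.
  split=> [j jd|]; first by lookup.
  rewrite take0; apply: (@frame_stored d) sX => j jP; lookup.
move=> k Y kn Yk [Yl sY].
have kT : k < size (enum T) by rewrite -cardE.
pose x := nth o (enum T) k.
have xk : enum_rank x = k :> nat.
  by rewrite /x -[k]/(nat_of_ord (Ordinal kn)) -enum_val_nth enum_valK.
have tY : tuned n Y by case: tX => X0 X1 X2; split; rewrite Yl //; lia.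
have bY : bound (upd r i d) (upd p i x) d.+1 Y.
  move=> j; rewrite /upd; case: eqP => _; first by rewrite ltnSn Yk xk.
  have [rj rX] := bX j; split; first by lia.
  by rewrite Yl ?rj.
apply: (does_weaken (leqnn _) _ (IHc _ _ _ _ _ tY (leqW d2) _ bY sY)) => [Z [Zl sZ]|].
  have [Y0 Y1 Y2] := tY.
  split; rewrite ?Zl //; try lia.
  split=> [j jd|]; first by lookup; rewrite Zl ?Yl //; lia.
  rewrite (take_nth o kT) foldl_rcons; apply: (@frame_stored d) sZ => j jP; lookup.
by lia.
Qed.

End Run.

(** * Polynomial time bounds and the complete machine *)

Definition poly_bounded (f : nat -> nat) : Prop :=
  exists c d, forall n, f n <= c * n ^ d + c.

Lemma poly_bounded_const a : poly_bounded (fun=> a).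
Proof. by exists a, 0 => n; rewrite leq_addl. Qed.

(** The added 1 is for [n = 0], where [0 ^ 0 = 1] exceeds the higher powers. *)
Lemma leq_expn_add1 n d d' : d <= d' -> n ^ d <= n ^ d' + 1.
Proof.
case: n => [|n] dd.
  by apply: (leq_trans _ (leq_addl _ _)); case: d {dd} => // d; rewrite exp0n.
by rewrite (leq_trans (leq_pexp2l _ dd)) ?leq_addr.
Qed.

Lemma poly_bounded_add f g :
  poly_bounded f -> poly_bounded g -> poly_bounded (fun n => f n + g n).
Proof.
move=> [c [d fP]] [c' [d' gP]]; exists (2 * c + 2 * c'), (maxn d d') => n.
have := leq_mul (leqnn c) (leq_expn_add1 n (leq_maxl d d')).
have := leq_mul (leqnn c') (leq_expn_add1 n (leq_maxr d d')).
have := fP n; have := gP n; set u := n ^ maxn d d'; nia.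
Qed.

Lemma poly_bounded_mul f : poly_bounded f -> poly_bounded (fun n => n * f n).
Proof.
move=> [c [d fP]]; exists (3 * c), d.+1 => n.
have := leq_mul (leqnn n) (fP n); rewrite mulnDr mulnCA -expnS.
have := leq_mul (leqnn c) (leq_expn_add1 n (ltn0Sn d)); rewrite expn1.
set u := n ^ d.+1; nia.
Qed.

Lemma poly_bounded_eval_time f : poly_bounded (eval_time f).
Proof.
elim: f => *; do ?[apply: poly_bounded_mul | apply: poly_bounded_add |
  apply: poly_bounded_const | assumption].
Qed.

Lemma poly_bounded_time c : poly_bounded (time c).
Proof.
have evalP := poly_bounded_eval_time.
elim: c => [k i j l f|a IHa b IHb|f c IHc|i c IHc] /=;
  do ?[apply: poly_bounded_mul | apply: poly_bounded_add |
  apply: poly_bounded_const | exact: evalP | assumption].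
have [a [d aP]] : poly_bounded (fun n => n * (time c n + 3) + 1).
  do ?[apply: poly_bounded_mul | apply: poly_bounded_add |
  apply: poly_bounded_const | assumption].
by exists a, d => n; rewrite -addn1.
Qed.

(** Registers 0 to 3 are reserved and work space runs from 4 to [B]. Input cell 0 gives the number
    of vertices, cell 1 the root; through register 3 every variable initially denotes the root. *)
Definition machine (c : cmd) (f : form) : program :=
  let B := 4 + (space c + eval_space f) in
  (ins (Const 2 1) ;; ins (Input 1 0) ;; ins (Input 3 2) ;;
   compile B (fun=> 3) 4 c ;; eval B (fun=> 3) 4 f ;; ins (Add 0 4 0)) 0.

Theorem machine_decides (c : cmd) (f : form) : exists C D : nat,
  forall (T : finType) (e : rel T) (r : T),
    decides_within (machine c f) (encode e r) (C * #|T| ^ D + C)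
      (holds e (run e c (fun=> r) (fun _ _ _ _ => false)) (fun=> r) f).
Proof.
have [C [D CD]] : poly_bounded (fun n => time c n + (eval_time f n + 1) + 3).
  do ?[apply: poly_bounded_add | apply: poly_bounded_const |
    exact: poly_bounded_time | exact: poly_bounded_eval_time].
exists C, D => T e r; rewrite /decides_within.
pose B := 4 + (space c + eval_space f).
set w := encode e r; set s := run _ _ _ _; set P := machine c f.
have : does w (ins (Const 2 1) ;; ins (Input 1 0) ;; ins (Input 3 2) ;;
   compile B (fun=> 3) 4 c ;; eval B (fun=> 3) 4 f ;; ins (Add 0 4 0))
  (fun=> 0) (time c #|T| + (eval_time f #|T| + 1)).+3
  (fun X => X 0 = holds e s (fun=> r) f).
  do 3![apply: does_step_seq => //]; set X := effect _ _ _.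
  have n0 : 0 < #|T| by apply/card_gt0P; exists r.
  have tX : tuned #|T| X by split.
  have bX : bound (fun=> 3) (fun=> r) 4 X by [].
  have sX : @stored T B (fun _ _ _ _ => false) X.
    move=> k x y z; have : B <= cell B #|T| k (enum_rank x) (enum_rank y) (enum_rank z).
      exact: leq_addl.
    by rewrite /X; lookup.
  apply: (does_seq (does_compile e r tX _ _ bX sX)) => [//||Y [Yl sY]].
    by rewrite /B; lia.
  have tY : tuned #|T| Y by case: tX => X0 X1 X2; split; rewrite Yl.
  have bY : bound (fun=> 3) (fun=> r) 4 Y by move=> i; rewrite Yl.
  apply: (does_seq (does_eval e r tY _ _ bY sY)) => [//||Z [Zd Zf]].
    by rewrite /B; lia.
  have [Z0 _ _] := @frame_tuned 4 _ _ _ _ isT Zf tY.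
  by apply: does_step => //; rewrite /effect /= /set_register /= Z0 addn0.
move=> /(_ [::] [::]) [t [X [tb eqt X0]]].
rewrite cats0 add0n in eqt.
have leT : t <= C * #|T| ^ D + C by apply: leq_trans (CD _); rewrite addn3.
(* A halted machine stays put, so the run can be padded to the time bound. *)
have halt k : iter k (step P w) (State (size P) X) = State (size P) X.
  by elim: k => //= k ->; rewrite /step /= onth_default.
rewrite -(subnK leT) iterD /initial_state eqt halt; split=> /=.
  by rewrite /halted.
by rewrite X0; case: holds.
Qed.

(** * Stackability and matchings *)

Section Matching.
Variable T : finType.

(** A matching is encoded by the involution that swaps partners; its fixed points are the unmatched
    vertices. *)
Definition matching (h : rel T) (m : T -> T) : Prop :=
  involutive m /\ forall x, m x != x -> h x (m x).

Definition covers (m : T -> T) (Y : {set T}) : Prop :=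
  forall y, y \in Y -> m y != y.

Definition coverable (h : rel T) (Y : {set T}) : Prop :=
  exists m, matching h m /\ covers m Y.

Variables (e : rel T) (r : T).

Definition delete_vertex : rel T := fun x y => [&& e x y, x != r & y != r].

(** In diameter two these are the vertices at distance two from [r]. *)
Definition far : {set T} := [set x | (x != r) && ~~ e x r].

Hypotheses (e_sym : symmetric e) (e_irr : irreflexive e).
Hypothesis diam : diameter e = 2.

(** The default value of [dist] is [#|T|], so with at most one vertex no distance reaches two. *)
Lemma card_ge2 : 1 < #|T|.
Proof.
rewrite ltnNge; apply/negP => T1; move: diam; apply/eqP.
rewrite neq_ltn ltnS; apply/orP; left.
apply/bigmax_leqP => x _; apply/bigmax_leqP => y _.
by apply: leq_trans (find_size _ _) _; rewrite size_iota.
Qed.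

Lemma distE x y : dist e x y = if x == y then 0 else if e x y then 1 else 2.
Proof.
have le2 : dist e x y <= 2.
  rewrite -diam; apply: leq_trans (leq_bigmax (F := fun x => \max_y dist e x y) x).
  exact: (leq_bigmax (F := dist e x) y).
have w0 : walk e 0 x y = (x == y).
  apply/existsP/idP => [[p]|xy]; first by rewrite (tuple0 p).
  by exists [tuple].
have w1 : walk e 1 x y = e x y.
  apply/existsP/idP => [[p]|xy].
    case/tupleP: p => z p; rewrite (tuple0 p) /= andbT.
    by case/andP=> exz /eqP <-.
  by exists [tuple y]; rewrite /= xy eqxx.
move: le2; rewrite /dist.
case: #|T| card_ge2 => [|[|n]] // _ /=; rewrite w0 w1.
(* Once lengths 0 and 1 have failed, [le2] forces the search to stop at 2; on two vertices this is
   the default value of [dist]. *)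
by case: (x == y); case: (e x y) => //= le2; congr _.+2; lia.
Qed.

Let T0 : 0 < #|T|. Proof. exact: leq_trans card_ge2. Qed.

Local Notation reach := (clos_refl_trans _ (cup_move e)).

(** Meant for [Z] not containing [r]: the cups of [Z] have reached [r] and the other vertices are
    untouched. *)
Definition emptied (Z : {set T}) : configuration T :=
  [ffun x => if x == r then #|Z|.+1 else x \notin Z : nat].

Lemma move_to_root (Z : {set T}) x : x != r -> e x r -> x \notin Z ->
  cup_move e (emptied Z) (emptied (x |: Z)).
Proof.
move=> xr er xZ; exists x, r.
have cx : emptied Z x = 1 by rewrite ffunE (negPf xr) xZ.
have cr : emptied Z r = #|Z|.+1 by rewrite ffunE eqxx.
rewrite cx cr distE (negPf xr) er; split=> //; apply/ffunP => y; rewrite !ffunE !inE.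
case: (eqVneq y r) => [->|yr]; first by rewrite eq_sym (negPf xr) cardsU1 xZ.
by case: eqP.
Qed.

(** The cup of [x] steps onto [y], and the two cups then jump the distance two from [y] to [r]. *)
Lemma stack_pair (Z : {set T}) x y : x != r -> y != r -> e x y -> ~~ e y r ->
  x \notin Z -> y \notin Z -> reach (emptied Z) (emptied (x |: (y |: Z))).
Proof.
move=> xr yr exy nyr xZ yZ.
have xy : x != y by apply: contraTneq exy => ->; rewrite e_irr.
pose C := [ffun z => if z == x then 0 else if z == y then 2 else emptied Z z].
apply: (rt_trans _ _ _ C); apply: rt_step.
  exists x, y; rewrite !ffunE (negPf xr) (negPf yr) xZ yZ distE (negPf xy) exy.
  by split=> //; apply/ffunP => z; rewrite !ffunE.
have Cy : C y = 2 by rewrite ffunE eq_sym (negPf xy) eqxx.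
have Cr : C r = #|Z|.+1.
  by rewrite ffunE eq_sym (negPf xr) eq_sym (negPf yr) ffunE eqxx.
exists y, r; rewrite Cy Cr distE (negPf yr) (negPf nyr).
split=> //; apply/ffunP => z; rewrite !ffunE !inE.
case: (eqVneq z r) => [->|zr].
  rewrite eq_sym (negPf yr) cardsU1 !inE (negPf xy) (negPf xZ) cardsU1 yZ.
  by rewrite addnA.
by case: (z == y); case: (z == x).
Qed.

(** Induction on the vertices outside [Z], a set closed under [m]. An unmatched vertex is a
    neighbour of [r] and sends its cup there. The cups of a matched pair go separately if both
    vertices are neighbours of [r]; otherwise they gather on one that is not. *)
Lemma coverable_stackable : coverable delete_vertex far -> stackable e r.
Proof.
case=> m [[mK mh] mcov].
have mr : m r = r.
  by apply/eqP; apply: contraT => /mh /and3P[_]; rewrite eqxx.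
have mN x : x != r -> m x != r.
  by move=> xr; rewrite -mr (inj_eq (inv_inj mK)).
rewrite /stackable.
have -> : all_cups_on r = emptied [set~ r].
  apply/ffunP => x; rewrite !ffunE !inE negbK; case: eqP => // _.
  by rewrite cardsC1 prednK.
have -> : one_cup_each T = emptied set0.
  by apply/ffunP => x; rewrite !ffunE !inE cards0; case: ifP.
suff H k (Z : {set T}) : #|~: Z| <= k -> r \notin Z -> (forall x, x \in Z -> m x \in Z) ->
    reach (emptied Z) (emptied [set~ r]).
  by apply: (H _ set0 (leqnn _)) => [|x]; rewrite inE.
elim: k Z => [|k IHk] Z Zk rZ mZ.
  by move: Zk; rewrite leqn0 cards_eq0 => /eqP/setP/(_ r); rewrite !inE rZ.
have [x|all_in] := pickP [pred x | (x != r) && (x \notin Z)]; last first.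
  rewrite (_ : [set~ r] = Z); first exact: rt_refl.
  apply/setP => x; rewrite !inE; have /= := all_in x.
  by case: eqP => [->|_] /=; [rewrite (negPf rZ) | move/negbFE->].
case/andP=> xr xZ.
have smaller (A : {set T}) : x \in A -> #|~: (A :|: Z)| <= k.
  move=> xA; rewrite -ltnS; apply: leq_trans Zk; apply: proper_card.
  by apply/properP; split; [rewrite setCS subsetUr | exists x; rewrite !inE ?xA].
have mxZ : m x \notin Z by apply: contra xZ => /mZ; rewrite mK.
have mxr := mN x xr.
have [fx|mx] := eqVneq (m x) x.
  have ex : e x r.
    by apply: contraT => nx; have := mcov x; rewrite inE xr nx fx eqxx => /(_ isT).
  apply: (rt_trans _ _ _ (emptied (x |: Z))).
    by apply: rt_step; apply: move_to_root.
  apply: IHk; first by apply: smaller; rewrite inE.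
    by rewrite !inE eq_sym negb_or xr.
  by move=> z /setU1P[->|/mZ mz]; rewrite ?fx !inE ?eqxx ?mz ?orbT.
have /and3P[exm _ _] := mh x mx.
have IH : reach (emptied (x |: (m x |: Z))) (emptied [set~ r]).
  apply: IHk; first by rewrite setUA; apply: smaller; rewrite !inE eqxx.
    by rewrite !inE ![r == _]eq_sym !negb_or xr mxr.
  move=> z; rewrite !inE => /or3P[/eqP->|/eqP->|/mZ->]; rewrite ?mK ?eqxx ?orbT //.
apply: (rt_trans _ _ _ _ _ _ IH).
have [xe|nx] := boolP (e x r); have [me|nm] := boolP (e (m x) r).
- apply: (rt_trans _ _ _ (emptied (m x |: Z))); apply: rt_step.
    exact: move_to_root.
  by apply: move_to_root; rewrite // !inE negb_or eq_sym mx.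
- exact: stack_pair.
- by rewrite setUCA; apply: stack_pair; rewrite // e_sym.
- exact: stack_pair.
Qed.

(** An empty root stays empty, and three cups off the root never move. Two cups on a neighbour of
    [r] cannot jump to [r], and wherever else they land they make at least three. *)
Definition stuck (C : configuration T) : Prop :=
  C r = 0 \/ exists2 x, x != r & (2 < C x) || e x r && (1 < C x).

(** [m] records the pairs of single cups merged so far; a vertex with just one cup is still free to
    be paired. *)
Definition progress (C : configuration T) (m : T -> T) : Prop :=
  [/\ matching delete_vertex m,
      forall x, x != r -> C x = 1 -> m x = x
    & forall x, x \in far -> C x != 1 -> m x != x].

Lemma progress_move C C' : cup_move e C C' ->
  stuck C \/ (exists m, progress C m) -> stuck C' \/ (exists m, progress C' m).
Proof.
case=> u [v [Cu Cv duv ->]].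
have uv : u != v by apply: contraTneq Cu => uv; rewrite -duv distE uv eqxx.
have C2 : 0 < C u <= 2 by rewrite -duv distE (negPf uv); case: (e u v).
have [->|ur] := eqVneq u r; first by left; left; rewrite ffunE eqxx.
case=> [[C0|[x xr xP]]|].
- left; left; rewrite ffunE eq_sym (negPf ur); case: eqP => // rv.
  by rewrite -rv C0 in Cv.
- have [xu|xu] := eqVneq x u.
    subst x; have [e1 e2] : e u r /\ C u = 2 by lia.
    have vr : v != r.
      by apply: contraTneq e1 => vr; move: duv; rewrite e2 distE vr (negPf ur); case: ifP.
    by left; right; exists v => //; rewrite ffunE eq_sym (negPf uv) eqxx; lia.
  left; right; exists x => //; rewrite ffunE (negPf xu); case: eqP => [xv|_] //.
  by subst x; lia.
case=> m [mm m1 m2].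
have [vr|vr] := eqVneq v r.
  right; exists m; split=> // x xr; rewrite ffunE; subst v.
    by case: (x == u) => //; rewrite (negPf xr); apply: m1.
  have xr' : x != r by move: xr; rewrite inE => /andP[].
  (* A far vertex that jumps to [r] held two cups, so it was covered before the move. *)
  case: (x =P u) => [xu _|_]; last by rewrite (negPf xr'); apply: m2.
  subst x; apply: m2 => //; rewrite -duv distE (negPf ur).
  by move: xr; rewrite inE => /andP[_ /negPf->].
case: (ltnP 2 (C u + C v)) => [gt2|le2].
  by left; right; exists v => //; rewrite ffunE eq_sym (negPf uv) eqxx gt2.
have [Cu1 Cv1] : C u = 1 /\ C v = 1 by lia.
have [ev|nv] := boolP (e v r).
  by left; right; exists v => //; rewrite ffunE eq_sym (negPf uv) eqxx ev Cu1 Cv1 orbT.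
have euv : e u v by move: duv; rewrite distE (negPf uv) Cu1; case: (e u v).
have [mu mv] := (m1 u ur Cu1, m1 v vr Cv1).
have [mK mh] := mm.
have mN z w : m w = w -> (m z == w) = (z == w).
  by move=> mw; rewrite -{1}mw (inj_eq (inv_inj mK)).
(* Both [u] and [v] held a single cup, hence are fixed by [m], and the edge between them can be
   added. *)
right; exists (fun z => if z == u then v else if z == v then u else m z).
split.
- split=> z.
    have [->|zu] := eqVneq z u; first by rewrite [v == u]eq_sym (negPf uv) eqxx.
    have [->|zv] := eqVneq z v; first by rewrite eqxx.
    by rewrite !mN // (negPf zu) (negPf zv) mK.
  have [->|zu] := eqVneq z u; first by rewrite /delete_vertex euv ur vr.
  have [->|zv] := eqVneq z v; last exact: mh.
  by rewrite /delete_vertex e_sym euv ur vr.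
- move=> x xr; rewrite ffunE; case: (x =P u) => // _; case: (x =P v) => // _; first by lia.
  exact: m1.
move=> x xf; rewrite ffunE; have [->|xu] := eqVneq x u; first by move=> _; rewrite eq_sym.
by have [->|xv] := eqVneq x v => //; apply: m2.
Qed.

(** The record starts as the identity. The final configuration is not stuck and leaves no far vertex
    with one cup, so the record covers [far]. *)
Lemma stackable_coverable : stackable e r -> coverable delete_vertex far.
Proof.
move=> st.
have ind C : reach (one_cup_each T) C -> stuck C \/ exists m, progress C m.
  move=> rC; have {rC} := Operators_Properties.clos_rt_rtn1 _ _ _ _ rC.
  elim=> [|C1 C2 C12 _]; last exact: progress_move.
  right; exists id; split=> [|//|x _]; last by rewrite ffunE.
  by split=> // x; rewrite eqxx.
have [[|[x xr]]|[m [mm _ mfar]]] := ind _ st.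
- by rewrite ffunE eqxx => T00; move: (T0); rewrite T00.
- by rewrite ffunE (negPf xr) andbF.
exists m; split=> // x xf; apply: mfar => //; rewrite ffunE.
by move: xf; rewrite inE => /andP[/negPf->].
Qed.

End Matching.

(** * Augmentation and contraction *)

Section Search.
Variables (T : finType) (h : rel T) (Y : {set T}).
Hypotheses (h_sym : symmetric h) (h_irr : irreflexive h).

Definition based (m : T -> T) (u : T) : Prop :=
  [/\ matching h m, u \in Y, m u = u & forall y, y \in Y -> y != u -> m y != y].

(** An exchange along an alternating path of two edges: the unmatched vertex moves from [u] to
    [m v]. *)
Definition rotate (m : T -> T) (u v x : T) : T :=
  if x == u then v else if x == v then u else if x == m v then x else m x.

Lemma rotate_matching m u v :
  matching h m -> m u = u -> h u v -> matching h (rotate m u v).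
Proof.
move=> [mK mh] mu huv; have uv : u != v by apply: contraTneq huv => ->; rewrite h_irr.
have mN z w : (m z == w) = (z == m w) by rewrite -{2}(mK z) (inj_eq (inv_inj mK)).
split=> x; rewrite /rotate.
  have [->|xu] := eqVneq x u; first by rewrite eqxx [v == u]eq_sym (negPf uv).
  have [->|xv] := eqVneq x v; first by rewrite eqxx.
  have [xw|xw] := eqVneq x (m v); first by rewrite (negPf xu) (negPf xv) xw eqxx.
  by rewrite !mN mu !mK (negPf xu) (negPf xw) (negPf xv).
have [->|xu] := eqVneq x u; first by [].
have [->|xv] := eqVneq x v; first by rewrite h_sym.
by case: ifP => [|_]; [rewrite eqxx | exact: mh].
Qed.

Lemma rotate_coverable m u v :
  based m u -> h u v -> m v = v \/ m v \notin Y -> coverable h Y.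
Proof.
move=> [mm uY mu mY] huv mv; have [mK _] := mm.
have uv : u != v by apply: contraTneq huv => ->; rewrite h_irr.
exists (rotate m u v); split=> [|y yY]; first exact: rotate_matching.
rewrite /rotate; have [->|yu] := eqVneq y u; first by rewrite eq_sym.
have [->|yv] := eqVneq y v; first by [].
case: (y =P m v) => [yw|_]; last exact: mY.
by case: mv => mv; [move: yv; rewrite yw mv eqxx | rewrite -yw yY in mv].
Qed.

(** An alternating forest given by matchings instead of edges: [D] holds the outer vertices, [A] the
    inner ones, and [t u] is the matching switched so as to miss [u]. The last clause is what
    refutes coverability when growth stops. *)
Definition forest (D A : {set T}) (t : T -> T -> T) : Prop :=
  [/\ forall u, u \in D -> based (t u) u,
      forall u a, u \in D -> a \in A -> (a \notin D) && (t u a \in D),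
      forall u d, u \in D -> d \in D -> d != u -> t u d \in A,
      forall u u' x, u \in D -> u' \in D -> x \notin A -> x \notin D ->
        t u x = t u' x
    & #|A| < #|D| ].

Lemma forest1 m u t : based m u -> t u =1 m -> forest [set u] set0 t.
Proof.
move=> bm tm; split; last by rewrite cards0 cards1.
- move=> x; rewrite inE => /eqP->; case: bm => -[mK mh] uY mu mY.
  by split; [split=> y; rewrite !tm; [exact: mK | exact: mh] | | rewrite tm | move=> y; rewrite tm; apply: mY].
- by move=> x a _; rewrite in_set0.
- by move=> x d; rewrite !inE => /eqP-> /eqP->; rewrite eqxx.
by move=> x x' y; rewrite !inE => /eqP-> /eqP->.
Qed.

(** All matchings of the family agree outside [D] and [A], so each of them contains the edge between
    [v] and [w]; these join [A] and [D] for all of them at once. *)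
Lemma forest_grow D A t t' u v w :
  forest D A t -> u \in D -> h u v -> v \notin D -> t u v = w ->
  w != v -> w \notin D -> w \in Y ->
  (forall x, t' x =1 if x == w then rotate (t u) u v else t x) ->
  forest (w |: D) (v |: A) t'.
Proof.
move=> [F1 F2 F3 F4 F5] uD huv vD tv wv wD wY t'E.
have [[tK th] uY tu tY] := F1 u uD.
have uv : u != v by apply: contraNneq vD => <-.
have uw : u != w by apply: contraNneq wD => <-.
have tw : t u w = v by rewrite -tv tK.
have vA : v \notin A by apply: contra wD => /(F2 _ _ uD) /andP[_]; rewrite tv.
have wA : w \notin A by apply: contra vD => /(F2 _ _ uD) /andP[_]; rewrite tw.
have told x : x \in D -> t' x =1 t x.
  by move=> xD y; rewrite t'E; case: eqP => // xw; rewrite -xw xD in wD.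
have tnew : t' w =1 rotate (t u) u v by move=> y; rewrite t'E eqxx.
have agree x : x \in D -> t x v = w /\ t x w = v.
  by move=> xD; rewrite !(F4 x u) // tv tw.
have rA a : a \in A -> rotate (t u) u v a = t u a.
  move=> aA; rewrite /rotate tv.
  have /andP[aD _] := F2 u a uD aA.
  have au : a != u by apply: contraNneq aD => ->.
  have av : a != v by apply: contraNneq vA => <-.
  have aw : a != w by apply: contraNneq wA => <-.
  by rewrite (negPf au) (negPf av) (negPf aw).
have rout x : x \notin v |: A -> x \notin w |: D -> rotate (t u) u v x = t u x.
  rewrite !inE !negb_or => /andP[xv xA] /andP[xw xD]; rewrite /rotate tv.
  by rewrite (negPf xv) (negPf xw); case: eqP => // xu; rewrite xu uD in xD.
split.
- move=> x; rewrite !inE => /orP[/eqP->|xD]; last first.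
    case: (F1 x xD) => -[xK xh] xY xx xcov.
    by split; [split=> y; rewrite !told //; exact: xh | | rewrite told //
      | move=> y yY yx; rewrite told //; apply: xcov].
  have [rK rh] : matching h (rotate (t u) u v) by apply: rotate_matching.
  split=> //; first by split=> y; rewrite !tnew; [exact: rK | exact: rh].
    by rewrite tnew /rotate tv eqxx (negPf wv) eq_sym (negPf uw).
  move=> y yY yw; rewrite tnew /rotate tv (negPf yw).
  have [->|yu] := eqVneq y u; first by rewrite eq_sym.
  by have [->|yv] := eqVneq y v; last exact: tY.
- move=> x a; rewrite !inE => /orP[/eqP->|xD] /orP[/eqP->|aA].
  + by rewrite negb_or [v == w]eq_sym wv vD tnew /rotate eqxx [v == u]eq_sym (negPf uv) uD orbT.
  + have /andP[aD taD] := F2 u a uD aA.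
    rewrite tnew rA // taD orbT negb_or aD.
    by rewrite !andbT; apply: contraNneq wA => <-.
  + rewrite told // (agree x xD).1 eqxx.
    by rewrite negb_or [v == w]eq_sym wv vD.
  have /andP[aD taD] := F2 x a xD aA.
  rewrite told // taD orbT negb_or aD !andbT.
  by apply: contraNneq wA => <-.
- move=> x d; rewrite !inE => /orP[/eqP->|xD] /orP[/eqP->|dD]; rewrite ?eqxx // => dx.
  + rewrite tnew /rotate; have [_|du] := eqVneq d u; first by rewrite eqxx.
    have dv : d != v by apply: contraNneq vD => <-.
    by rewrite (negPf dv) tv (negPf dx) F3 ?orbT.
  + by rewrite told // (agree x xD).2 eqxx.
  by rewrite told // F3 ?orbT.
- move=> x x' y xD x'D yA yD.
  have E z : z \in w |: D -> t' z y = t u y.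
    rewrite !inE => /orP[/eqP->|zD]; first by rewrite tnew rout.
    rewrite told //; move: yA yD; rewrite !inE !negb_or => /andP[_ yA] /andP[_ yD].
    exact: F4.
  by rewrite !E.
by rewrite !cardsU1 vA wD ltn_add2l.
Qed.

(** Under a covering matching [N], the partner of [d] in [D] is outside [D] and [t d] sends it into
    [D], hence it lies in [A]. So [N] would inject [D] into the smaller set [A]. *)
Lemma forest_stuck D A t : forest D A t ->
  (forall u v, u \in D -> h u v -> v \notin D /\ t u v \in D) ->
  ~ coverable h Y.
Proof.
move=> [F1 F2 F3 F4 F5] st [N [[NK Nh] NY]]; move: F5; rewrite ltnNge => /negP; apply.
rewrite -(card_imset _ (inv_inj NK)); apply: subset_leq_card.
apply/subsetP => _ /imsetP[d dD ->].
have [[tK _] dY td _] := F1 d dD.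
have [ND tND] := st d _ dD (Nh _ (NY d dY)).
have := F3 d _ dD tND; rewrite tK; apply.
by apply: contraNneq ND => E; rewrite -(tK (N d)) E td.
Qed.

End Search.

(** * Orbits of two involutions *)

Section Dihedral.
Variables (T : finType) (f g : T -> T) (u : T).
Hypotheses (fK : involutive f) (gK : involutive g) (fu : f u = u).

(* The orbit of [u] under the dihedral group generated by [f] and [g], indexed
   by the powers of the rotation [f \o g]; [f] and [g] act as reflections. *)
Lemma dihedral_orbit : exists p (z : nat -> T), [/\ 0 < p, z 0 = u,
  {in gtn p &, injective z}, forall i, 0 < i < p -> f (z i) = z (p - i)
  & forall i, i < p -> g (z i) = z (p - i.+1)].
Proof.
pose phi x := f (g x).
have phi_inj : injective phi.
  by apply: inj_comp; [apply: inv_inj fK | apply: inv_inj gK].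
pose z i := iter i phi u; pose p := order phi u.
have zp : z p = u by apply: iter_order.
(* Conjugation by [f] inverts the rotation, and [f] fixes [u]. *)
have back i : iter i phi (f (z i)) = u.
  elim: i => //= i IH; rewrite -iterS iterSr {2}/phi.
  by rewrite -[RHS]IH; congr (iter _ _ _); rewrite /phi !fK gK.
have fz i : i <= p -> f (z i) = z (p - i).
  move=> ip; have inj : injective (iter i phi).
    by elim: i {ip} => //= i IH; apply: inj_comp.
  by apply: inj; rewrite back /z -iterD subnKC.
exists p, z; split=> //.
- exact: order_gt0.
- move=> i j ip jp zij; rewrite -(@findex_iter _ phi u i) // -(@findex_iter _ phi u j) //.
  by rewrite -/(z i) zij.
- by move=> i /andP[_ ip]; apply: fz; apply: ltnW.
by move=> i ip; rewrite -fz // /z /= /phi fK.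
Qed.

End Dihedral.

Ltac split_if := repeat match goal with |- context [if ?b then _ else _] =>
  lazymatch b with
  | context [if _ then _ else _] => fail
  | _ => case: (boolP b) => ?
  end end.

(** * Odd cycles and factor-critical sets *)

Section Contract.
Variables (T : finType) (h : rel T) (Y : {set T}).
Hypotheses (h_sym : symmetric h) (h_irr : irreflexive h).

(** The graph induced on [C] is factor-critical. *)
Definition critical (C : {set T}) : Prop := forall x, x \in C -> exists k : T -> T,
  [/\ forall y, y \in C -> k y \in C, forall y, y \in C -> k (k y) = y,
      forall y, y \in C -> k y != y -> h y (k y)
    & forall y, y \in C -> (k y == y) = (y == x)].

(** Reduces matchings of a cycle to arithmetic on indices. *)
Lemma index_matching p (z : nat -> T) (C : {set T}) (k : nat -> nat) a :
  {in gtn p &, injective z} -> (forall y, y \in C -> exists2 i, i < p & z i = y) ->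
  (forall i, i < p -> z i \in C) ->
  (forall i, i < p -> k i < p /\ k (k i) = i) ->
  (forall i, i < p -> k i <> i -> h (z i) (z (k i))) ->
  (forall i, i < p -> k i = i <-> i = a) -> a < p ->
  exists k : T -> T,
  [/\ forall y, y \in C -> k y \in C, forall y, y \in C -> k (k y) = y,
      forall y, y \in C -> k y != y -> h y (k y)
    & forall y, y \in C -> (k y == y) = (y == z a)].
Proof.
move=> z_inj zC Cz kP kh ka ap.
pose s := mkseq z p; pose idx y := index y s.
have idxE i : i < p -> idx (z i) = i.
  move=> ip; rewrite /idx -(nth_mkseq (z 0) z ip) index_uniq ?size_mkseq //.
  by rewrite map_inj_in_uniq ?iota_uniq // => i' j'; rewrite !mem_iota; apply: z_inj.
exists (fun y => z (k (idx y))).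
split=> y /zC[i ip <-]; have [kp kK] := kP i ip; rewrite !idxE //.
- exact: Cz.
- by rewrite kK.
- move=> zz; apply: kh => // kk; by rewrite kk eqxx in zz.
have E i' j' : i' < p -> j' < p -> (z i' == z j') = (i' == j').
  by move=> *; apply: (inj_in_eq z_inj).
by rewrite !E //; have := ka i ip; do 2!case: eqP => //; intuition.
Qed.

Variables (D A : {set T}) (t : T -> T -> T) (u v : T) (C : {set T}).
Hypotheses (F : forest h Y D A t) (uD : u \in D) (vD : v \in D) (huv : h u v).
Hypotheses (uC : u \in C) (fC : forall x, x \in C -> t u x \in C).
Hypothesis gC : forall x, x \in C -> t v x \in C.
Hypothesis C_min : forall S : {set T}, u \in S ->
  (forall x, x \in S -> t u x \in S) -> (forall x, x \in S -> t v x \in S) ->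
  C \subset S.

(** The edges of [t v] and [t u] form a path [z 0], [z (p - 1)], [z 1], [z (p - 2)] and so on. It
    starts at [u] and ends at [v], the edge between [u] and [v] closes it, and the cycle is odd
    because [t v] fixes [v]. *)
Lemma blossom : [/\ v \in C, critical C & forall x, x \in C -> x != u -> t u x != x].
Proof.
have [F1 F2 F3 F4 F5] := F.
have [[fK fh] uY fu _] := F1 u uD; have [[gK gh] vY gv _] := F1 v vD.
have [p [z [p0 z0 z_inj fz gz]]] := dihedral_orbit fK gK fu.
have zC i : i < p -> z i \in C.
  (* Membership is propagated in the order of the path, in which low and high indices alternate. *)
  have zC2 k : (2 * k < p -> z k \in C) /\ (2 * k + 1 < p -> z (p - k.+1) \in C).
    elim: k => [|k [IH1 IH2]].
      by split=> kp; rewrite ?z0 // -gz // gC // z0.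
    have zk : 2 * k.+1 < p -> z k.+1 \in C.
      move=> kp; have -> : k.+1 = p - (p - k.+1) by lia.
      by rewrite -fz; [apply/fC/IH2; lia | lia].
    by split=> // kp; rewrite -gz; [apply/gC/zk; lia | lia].
  move=> ip; case: (ltnP (2 * i) p) => i2; first by have [H _] := zC2 i; exact: H.
  have -> : i = p - (p - i.+1).+1 by lia.
  by have [_ H] := zC2 (p - i.+1); apply: H; lia.
have Cz y : y \in C -> exists2 i, i < p & z i = y.
  have sub : C \subset [set z (i : 'I_p) | i in setT].
    have z_in i : i < p -> z i \in [set z (i : 'I_p) | i in setT].
      by move=> ip; apply/imsetP; exists (Ordinal ip); rewrite ?inE.
    apply: C_min; first by rewrite -z0; apply: z_in.
      move=> _ /imsetP[i _ ->]; have := ltn_ord i; case: (posnP i) => [->|i0] ip.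
        by rewrite z0 fu -z0 z_in.
      by rewrite fz ?i0 ?z_in //; lia.
    by move=> _ /imsetP[i _ ->]; rewrite gz ?z_in //; have := ltn_ord i; lia.
  by move=> /(subsetP sub)/imsetP[i _ ->]; exists i.
(* If the orbit avoided [v], then [t v] would send each [z i] from [D] into [A] and [t u] would send
   it back into [D]. After the last [z i] this puts [u] itself into [A], which is disjoint from
   [D]. *)
have [l lp zl] : exists2 l, l < p & z l = v.
  have [/'exists_eqP[l zl]|/existsPn nv] := boolP [exists i : 'I_p, z i == v].
    by exists l.
  have zD i : i < p -> z i \in D.
    elim: i => [|i IHi] ip; first by rewrite z0.
    have ziD : z i \in D by apply: IHi; lia.
    have zA : t v (z i) \in A.
      by apply: F3 => //; have /= := nv (Ordinal (ltnW ip)).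
    have -> : i.+1 = p - (p - i.+1) by lia.
    by rewrite -fz -?gz; [have /andP[_ ->] := F2 u _ uD zA | lia | lia].
  have ip : p.-1 < p by lia.
  have : t v (z p.-1) \in A by apply: F3 => //; [apply: zD | have /= := nv (Ordinal ip)].
  by rewrite gz // prednK // subnn z0 => /(F2 u _ uD); rewrite uD.
have p2 : p = l + l + 1.
  have := gz l lp; rewrite zl gv -zl => /z_inj E.
  have : l = p - l.+1 by apply: E; rewrite inE; lia.
  by lia.
have edge i : 0 < i < p -> h (z i) (z (p - i)).
  move=> ip; rewrite -fz //; apply: fh; rewrite fz //; apply/eqP => /z_inj E.
  by have := E _ _; rewrite !inE; lia.
have edge' i : i < p -> i <> l -> h (z i) (z (p - i.+1)).
  move=> ip il; rewrite -gz //; apply: gh; rewrite gz //; apply/eqP => /z_inj E.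
  by have := E _ _; rewrite !inE; lia.
split; first by rewrite -zl zC.
- move=> _ /Cz[a ap <-]; case: (leqP a l) => al.
    (* Here [z a] has even position on the path: edges of [t v] match what precedes it and edges of
       [t u] what follows it. *)
    pose k i := if i == a then a else
      if (i < a) || (p - a <= i) then p - i.+1 else p - i.
    apply: (@index_matching p z C k a) => // i ip.
    + by rewrite /k; clear -ip ap al p2; split; split_if; lia.
    + rewrite /k; split_if => ne; [exfalso | apply: edge' | apply: edge]; lia.
    by rewrite /k; clear -ip ap al p2; split; split_if; lia.
  (* Now the position of [z a] is odd. The closing edge matches [z 0] with [z l], then edges of
     [t u] are used before [z a] and edges of [t v] after it. *)
  pose b := p - a.
  pose k i := if i == a then a else if i == 0 then l else if i == l then 0 else
      if (i < b) || (p - b < i) then p - i else p - i.+1.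
  apply: (@index_matching p z C k a) => // i ip.
  + by rewrite /k; clear -ip ap al p2; split; split_if; lia.
  + rewrite /k; split_if => ne.
    * by exfalso; lia.
    * have -> : i = 0 by lia.
      by rewrite z0 zl.
    * have -> : i = l by lia.
      by rewrite z0 zl h_sym.
    * by apply: edge; lia.
    by apply: edge'; lia.
  by rewrite /k; clear -ip ap al p2; split; split_if; lia.
move=> _ /Cz[i ip <-] iu; have i0 : 0 < i.
  by case: i iu {ip} => //; rewrite z0 eqxx.
rewrite fz ?i0 //; apply/eqP => /z_inj E.
by have := E _ _; rewrite !inE; lia.
Qed.

End Contract.

(** * Contraction of a blossom *)

Section Contraction.
Variables (T : finType) (h : rel T) (Y : {set T}).
Hypotheses (h_sym : symmetric h) (h_irr : irreflexive h).

(* [u] stands for the contracted set; the rest of [C] becomes isolated. *)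
Definition contract (C : {set T}) (u : T) : rel T := fun x y =>
  if x \in C then [&& x == u, y \notin C & [exists b in C, h b y]]
  else if y \in C then (y == u) && [exists b in C, h b x] else h x y.

Lemma contract_sym C u : symmetric (contract C u).
Proof.
move=> x y; rewrite /contract; case: (x \in C); case: (y \in C) => //=.
by rewrite andbF andbF.
Qed.

Lemma contract_irr C u : irreflexive (contract C u).
Proof. by move=> x; rewrite /contract; case: (x \in C) => //=; rewrite andbF. Qed.

Variables (f : T -> T) (u : T) (C : {set T}).
Hypotheses (bf : based h Y f u) (uC : u \in C).
Hypotheses (fC : forall x, x \in C -> f x \in C) (critC : critical h C).
Hypothesis f_cov : forall x, x \in C -> x != u -> f x != x.

Let fK : involutive f. Proof. by case: bf => -[]. Qed.
Let fh x : f x != x -> h x (f x). Proof. by case: bf => -[_ fh _ _ _]; apply: fh. Qed.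
Let fu : f u = u. Proof. by case: bf. Qed.
Let fY y : y \in Y -> y != u -> f y != y. Proof. by case: bf => _ _ _; apply. Qed.

Let fNC x : x \notin C -> f x \notin C.
Proof. by apply: contra => /fC; rewrite fK. Qed.

Lemma contract_based :
  based (contract C u) (u |: (Y :\: C)) (fun x => if x \in C then x else f x) u.
Proof.
split; rewrite ?inE ?eqxx ?uC //.
- split=> x.
    have [xC|xC] := boolP (x \in C); first by rewrite xC.
    by rewrite (negPf (fNC xC)) fK.
  rewrite /contract; case: ifP => [_|/negbT xC]; first by rewrite eqxx.
  by rewrite (negPf (fNC xC)); apply: fh.
move=> y; rewrite !inE => /predU1P[->|/andP[/negPf->]]; first by rewrite eqxx.
exact: fY.
Qed.

(** Inside [C], let [x] be the vertex left out instead of [u]; outside, keep [f]. *)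
Lemma uncovered_blossom x : x \in C -> x \notin Y -> coverable h Y.
Proof.
move=> xC xY; have [k [k1 k2 k3 k4]] := critC xC.
exists (fun y => if y \in C then k y else f y); split.
  split=> y; have [yC|yC] := boolP (y \in C).
  - by rewrite k1 // k2.
  - by rewrite (negPf (fNC yC)) fK.
  - exact: k3.
  exact: fh.
move=> y yY; case: ifP => [yC|/negbT yC].
  by rewrite k4 //; apply: contraNneq xY => <-.
by apply: fY => //; apply: contraNneq yC => ->.
Qed.

(** The partner [z] of [u] has a neighbour [b] in [C]: match these two, and the rest of [C] by
    criticality. *)
Lemma contract_sound : coverable (contract C u) (u |: (Y :\: C)) -> coverable h Y.
Proof.
case=> N [[NK Nh] NY].
have Nu : N u != u by apply: NY; rewrite !inE eqxx.
have := Nh _ Nu; rewrite /contract uC eqxx /= => /andP[zC /exists_inP[b bC hbz]].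
set z := N u in Nu zC hbz.
have [k [k1 k2 k3 k4]] := critC bC.
have NC x : x \notin C -> x != z -> N x \notin C.
  move=> xC xz; have [->//|Nx] := eqVneq (N x) x.
  have := Nh x Nx; rewrite /contract (negPf xC); case: ifP => // _ /andP[/eqP E _].
  by case/eqP: xz; rewrite /z -E NK.
have Nz x : x \notin C -> N x != z.
  by apply: contraNneq => E; rewrite -(NK x) E /z NK.
have zb : z != b by apply: contraNneq zC => ->.
exists (fun x => if x == z then b else if x == b then z else
  if x \in C then k x else N x).
have kb : k b = b by apply/eqP; rewrite k4.
have kN x : x \in C -> x != b -> k x != b.
  by move=> xC xb; apply: contra xb => /eqP E; rewrite -(k2 x) // E kb.
split.
  split=> x; have [->|xz] := eqVneq x z.
  - by rewrite [b == z]eq_sym (negPf zb) eqxx.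
  - have [->|xb] := eqVneq x b; first by rewrite eqxx.
    have [xC|xC] := boolP (x \in C).
      have kz : k x != z by apply: contraNneq zC => <-; apply: k1.
      by rewrite (negPf kz) (negPf (kN x xC xb)) k1 // k2.
    have Nb : N x != b by apply: contraNneq (NC x xC xz) => ->.
    by rewrite (negPf (Nz x xC)) (negPf Nb) (negPf (NC x xC xz)) NK.
  - by rewrite h_sym.
  have [->|xb] := eqVneq x b; first by [].
  have [xC|xC] := boolP (x \in C); first exact: k3.
  move=> Nx; have := Nh x Nx.
  by rewrite /contract (negPf xC) (negPf (NC x xC xz)).
move=> y yY; have [->|yz] := eqVneq y z; first by rewrite eq_sym.
have [->|yb] := eqVneq y b; first by [].
have [yC|yC] := boolP (y \in C); first by rewrite k4.
by apply: NY; rewrite !inE yC yY orbT.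
Qed.

Hypothesis CY : C \subset Y.

(** Follow the path from [u] that alternates between [N] and [f] until it leaves [C] for the last
    time, by an [N]-edge to [w]. Match [u] with [w], use [N] on the remainder [R] of the path and
    [f] elsewhere outside [C]. *)
Lemma contract_complete : coverable h Y -> coverable (contract C u) (u |: (Y :\: C)).
Proof.
case=> N [[NK Nh] NY].
have [p [z [p0 z0 z_inj fz Nz]]] := dihedral_orbit fK NK fu.
have E i j : i < p -> j < p -> (z i == z j) = (i == j).
  by move=> ip jp; apply: (inj_in_eq z_inj).
(* Low indices suffice to find the last vertex in [C], because [f] preserves [C] and pairs [z i]
   with [z (p - i)]. *)
have [j /andP[jp jC] jmax] : exists2 j, (2 * j < p) && (z j \in C) &
    forall i, (2 * i < p) && (z i \in C) -> i <= j.
  have ex : exists i, (2 * i < p) && (z i \in C) by exists 0; rewrite z0 uC p0.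
  have ub i : (2 * i < p) && (z i \in C) -> i <= p by lia.
  by exists (ex_maxn ex ub); case: ex_maxnP.
have j2 : 2 * j + 1 < p.
  have : z (p - j.+1) != z j by rewrite -Nz; [apply/NY/(subsetP CY) | lia].
  by rewrite E; lia.
have out i : j < i < p - j -> z i \notin C.
  move=> ij; apply/negP => iC.
  case: (ltngtP (2 * i) p) => i2.
  - by have := jmax i; rewrite i2 iC; lia.
  - have := jmax (p - i); rewrite -fz; last by lia.
    by rewrite fC //; lia.
  have : f (z i) != z i by apply: f_cov => //; rewrite -z0 E; lia.
  by rewrite fz ?E; lia.
pose R := [set z (i : 'I_p) | i : 'I_p & j < i < p - j].
have RP x : reflect (exists2 i, j < i < p - j & x = z i) (x \in R).
  apply: (iffP imsetP) => [[i]|[i ij ->]]; first by rewrite inE => ij ->; exists i.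
  have ip : i < p by lia.
  by exists (Ordinal ip); rewrite ?inE.
have RC x : x \in R -> x \notin C by case/RP=> i ij ->; apply: out.
have fR x : x \in R -> f x \in R.
  by case/RP=> i ij ->; rewrite fz; [apply/RP; exists (p - i) => //; lia | lia].
pose w := z (p - j.+1).
have wR : w \in R by apply/RP; exists (p - j.+1) => //; lia.
have wC := RC w wR.
have uw : u != w by apply: contraNneq wC => <-.
have NR x : x \in R -> x != w -> (N x \in R) && (N x != w).
  case/RP=> i ij -> iw; have ne : i != p - j.+1 by move: iw; rewrite /w E; lia.
  rewrite Nz; last by lia.
  apply/andP; split; last by rewrite /w E; lia.
  by apply/RP; exists (p - i.+1) => //; lia.
have fNR x : x \notin R -> f x \notin R by apply: contra => /fR; rewrite fK.
have uR : u \notin R by apply: contraTN uC => /RC.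
have hjw : [exists b in C, h b w].
  apply/exists_inP; exists (z j) => //; rewrite /w -Nz; last by lia.
  by apply/Nh/NY/(subsetP CY).
exists (fun x => if x == u then w else if x == w then u else
  if x \in C then x else if x \in R then N x else f x).
split.
  split=> x; have [->|xu] := eqVneq x u.
  - by rewrite [w == u]eq_sym (negPf uw) eqxx.
  - have [->|xw] := eqVneq x w; first by rewrite eqxx.
    have [xC|xC] := boolP (x \in C); first by rewrite (negPf xu) (negPf xw) xC.
    have [xR|xR] := boolP (x \in R).
      have /andP[NxR Nxw] := NR x xR xw.
      have Nxu : N x != u by apply: contraNneq uR => <-.
      by rewrite (negPf Nxu) (negPf Nxw) (negPf (RC _ NxR)) NxR NK.
    have fxu : f x != u by apply: contraNneq (fNC xC) => ->.
    have fxw : f x != w by apply: contraNneq (fNR x xR) => ->.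
    by rewrite (negPf fxu) (negPf fxw) (negPf (fNC xC)) (negPf (fNR x xR)) fK.
  - by rewrite /contract uC eqxx wC hjw.
  have [->|xw] := eqVneq x w; first by rewrite /contract (negPf wC) uC eqxx hjw.
  have [xC|xC] := boolP (x \in C); first by rewrite eqxx.
  rewrite /contract (negPf xC); have [xR|xR] := boolP (x \in R).
    by have /andP[NxR _] := NR x xR xw; rewrite (negPf (RC _ NxR)); apply: Nh.
  by rewrite (negPf (fNC xC)); apply: fh.
move=> y; rewrite !inE; have [->|yu] := eqVneq y u; first by rewrite eq_sym.
move=> /= /andP[yC yY]; have [->|yw] := eqVneq y w; first by [].
rewrite (negPf yC); case: ifP => _; first exact: NY.
exact: fY.
Qed.

Lemma contract_smaller v : v \in C -> v != u -> #|u |: (Y :\: C)| < #|Y|.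
Proof.
move=> vC vu; apply: proper_card; apply/properP; split.
  by apply/subsetP => x; rewrite !inE => /predU1P[->|/andP[]//]; apply: (subsetP CY).
by exists v; [apply: (subsetP CY) | rewrite !inE (negPf vu) vC].
Qed.

End Contraction.

(** * Merging forced edges into a matching *)

Section Prune.
Variables (T : finType) (G : rel T) (Y : {set T}) (m N : T -> T).
Hypotheses (G_sym : symmetric G) (mm : matching G m) (NG : matching G N).
Hypotheses (NY : covers N Y) (tight : forall x y, G x y -> m x != y -> N x = y).

Definition fresh : rel T := fun x y => G x y && (m x != y).

(** The fresh edges all lie in [N], so they form a matching; an edge of [m] is kept when neither end
    meets a fresh edge. *)
Definition combine (x : T) : T :=
  if [exists y, fresh x y] then N x
  else if [exists y, fresh (m x) y] then x else m x.

Lemma fresh_sym : symmetric fresh.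
Proof.
have [mK _] := mm.
move=> x y; rewrite /fresh G_sym; congr (_ && ~~ _).
by apply/eqP/eqP => <-; rewrite mK.
Qed.

Let freshN x y : fresh x y -> N x = y.
Proof. by case/andP; apply: tight. Qed.

Lemma combineE x y : (combine x == y) = fresh x y || (~~ [exists z, fresh x z] &&
  ((m x == y) && ~~ [exists z, fresh y z] || (x == y) && [exists z, fresh (m x) z])).
Proof.
rewrite /combine; case: existsP => [[z xz]|nx] /=.
  rewrite orbF (freshN xz); apply/eqP/idP => [<-//|/freshN <-]; exact: esym (freshN xz).
have -> : fresh x y = false by apply/negP => xy; case: nx; exists y.
have [exy|nex] := boolP [exists z, fresh (m x) z]; rewrite ?andbT ?andbF ?orbF /=.
  case: eqP => [<-|_]; first by rewrite orbT.
  by rewrite orbF; case: eqP => // <-; rewrite exy.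
by case: eqP => // <-; rewrite nex.
Qed.

Lemma combine_matching : matching G combine.
Proof.
have [[mK mG] [NK Gh]] := (mm, NG).
have ex_fresh x z : fresh x z -> [exists y, fresh x y] by move=> xz; apply/existsP; exists z.
split=> x; rewrite /combine.
  have [/existsP[y xy]|nx] := boolP [exists y, fresh x y].
    rewrite (freshN xy) (ex_fresh y x) 1?fresh_sym //.
    by rewrite (@freshN y x) // fresh_sym.
  have [ex|nmx] := boolP [exists y, fresh (m x) y].
    by rewrite (negPf nx) ex.
  by rewrite (negPf nmx) mK (negPf nx).
case: ifP => _; first exact: Gh.
by case: ifP => _; [rewrite eqxx | exact: mG].
Qed.

(** If [y] meets no fresh edge, its edge in [N] is also its edge in [m]. A fresh edge at [m y] would
    lie in [N], hence lead back to [y], so [m] covers [y] and its edge is kept. *)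
Lemma combine_covers : covers combine Y.
Proof.
have [[mK mG] [NK NGh]] := (mm, NG).
move=> y yY; have yN := NY yY; rewrite /combine.
case: existsP => [//|ny].
have mN : m y = N y.
  apply/eqP; apply: contraT => ne; case: ny; exists (N y).
  by rewrite /fresh ne NGh.
case: existsP => [[z]|_]; last by rewrite mN.
rewrite mN => /[dup] /freshN; rewrite NK => <-; rewrite fresh_sym => yz.
by case: ny; exists (N y).
Qed.

End Prune.

(** * The algorithm *)

Fixpoint avoids (k : nat) (f : form) : bool :=
  match f with
  | Edge _ _ | Eq _ _ => true
  | Rel j _ _ _ => j != k
  | Neg f | Ex _ f => avoids k f
  | And f g | Or f g => avoids k f && avoids k g
  end.

Fixpoint writes (c : cmd) : seq nat :=
  match c with
  | Put k _ _ _ _ => [:: k]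
  | Seq a b => writes a ++ writes b
  | When _ c | For _ c => writes c
  end.

(** Cells change one at a time while [f] is still being evaluated, so this is sound only when [f]
    does not mention [k]. *)
Definition Fill (k : nat) (f : form) : cmd :=
  For 0 (For 1 (For 2 (Put k 0 1 2 f))).

(* Relation 0 is a buffer, so that [f] may mention the relation being set. *)
Definition Assign (k : nat) (f : form) : cmd :=
  Seq (Fill 0 f) (Fill k (Rel 0 0 1 2)).

(** * Loops as folds and the meaning of assignments *)

Section Folds.
Variables (S U : Type).

Lemma foldl_ind (I : seq U -> S -> Prop) (act : S -> U -> S) s l :
  I [::] s -> (forall l' x s', I l' s' -> I (rcons l' x) (act s' x)) ->
  I l (foldl act s l).
Proof.
move=> I0 IS; elim/last_ind: l => //= l x IHl.
by rewrite foldl_rcons; apply: IS.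
Qed.

End Folds.

Section Language.
Variables (T : finType) (e : rel T).
Implicit Types (s : rels T) (p : nat -> T).

Lemma run_Seq a b p s : run e (Seq a b) p s = run e b p (run e a p s).
Proof. by []. Qed.

Lemma run_When f c p s :
  run e (When f c) p s = if holds e s p f then run e c p s else s.
Proof. by []. Qed.

Lemma run_For i c p s :
  run e (For i c) p s = foldl (fun s x => run e c (upd p i x) s) s (enum T).
Proof. by []. Qed.

Lemma run_frame j c p s : j \notin writes c -> run e c p s j = s j.
Proof.
elim: c p s => [k a b l f|a IHa b IHb|f c IHc|i c IHc] p s /= jc.
- by rewrite /upd; move: jc; rewrite inE => /negPf->.
- by move: jc; rewrite mem_cat negb_or => /andP[ja jb]; rewrite IHb // IHa.
- by case: ifP => _ //; apply: IHc.
by apply: (foldl_ind (I := fun _ s' => s' j = s j)) => // l x s' <-; apply: IHc.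
Qed.

Lemma holds_ext k f p s s' : avoids k f -> (forall j, j != k -> s' j = s j) ->
  holds e s' p f = holds e s p f.
Proof.
move=> + ss'; elim: f p => //= [j a b c|f IHf|f IHf g IHg|f IHf g IHg|i f IHf] p.
- by move=> /ss' ->.
- by move=> /IHf->.
- by case/andP=> /IHf-> /IHg->.
- by case/andP=> /IHf-> /IHg->.
by move=> af; apply: eq_existsb => x; apply: IHf.
Qed.

(** The new values [F] depend only on relations other than [k], which stay as in [s0], so the order
    of the updates does not matter. It is used once for each of the nested loops of [Fill]. *)
Lemma fold_cells k (F : T -> T -> T -> bool) s0 (Q : T -> T -> T -> T -> bool)
    (act : rels T -> T -> rels T) l s :
  (forall s x, (forall j, j != k -> s j = s0 j) -> forall j a b c,
    act s x j a b c = if (j == k) && Q x a b c then F a b c else s j a b c) ->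
  (forall s x j, j != k -> act s x j = s j) ->
  (forall j, j != k -> s j = s0 j) -> forall j a b c,
  foldl act s l j a b c =
    if (j == k) && has (fun x => Q x a b c) l then F a b c else s j a b c.
Proof.
move=> actE actk; elim: l s => /= [|x l IHl] s sE j a b c; first by rewrite andbF.
rewrite IHl => [|i ik]; last by rewrite actk ?sE.
rewrite actE //; case: (j == k) => //=.
by case: (has _ l); rewrite ?orbT ?orbF.
Qed.

Definition env3 p x y z : nat -> T := upd (upd (upd p 0 x) 1 y) 2 z.

Lemma run_Fill k f p s j x y z : avoids k f ->
  run e (Fill k f) p s j x y z =
    if j == k then holds e s (env3 p x y z) f else s j x y z.
Proof.
move=> af; pose F x y z := holds e s (env3 p x y z) f.
have frame c i p' s' j' : writes c = [:: k] -> j' != k ->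
    run e (For i c) p' s' j' = s' j'.
  by move=> wc jk; apply: run_frame; rewrite /= wc inE.
have hasE (P : pred T) x0 : (forall x', P x' -> x' = x0) -> has P (enum T) = P x0.
  move=> P0; apply/hasP/idP => [[x' _ Px]|Px]; first by rewrite -(P0 x').
  by exists x0; rewrite ?mem_enum.
rewrite run_For (@fold_cells k F s (fun x' a b c => a == x')) //; first last.
- by move=> s' x' j' jk; apply: frame.
- move=> s1 x1 sE1 j1 a1 b1 c1; rewrite run_For.
  rewrite (@fold_cells k F s (fun y' a b c => (a == x1) && (b == y'))) //; first last.
  + by move=> s' x' j' jk; apply: frame.
  + move=> s2 y2 sE2 j2 a2 b2 c2; rewrite run_For.
    rewrite (@fold_cells k F s
      (fun z' a b c => [&& a == x1, b == y2 & c == z'])) //; first last.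
    * by move=> s' x' j' jk; apply: run_frame; rewrite inE.
    * move=> s3 z3 sE3 j3 a3 b3 c3; rewrite /= {1}/upd; case: eqP => //= ->.
      case: ifP => // /and3P[/eqP-> /eqP-> /eqP->].
      exact: (holds_ext _ af sE3).
    by rewrite (hasE _ c2) ?eqxx ?andbT // => z' /and3P[_ _ /eqP].
  by rewrite (hasE _ b1) ?eqxx ?andbT // => z' /andP[_ /eqP].
by rewrite (hasE _ x) ?eqxx ?andbT // => z' /eqP.
Qed.

Lemma run_Assign k f p s j x y z : avoids 0 f -> k != 0 -> j != 0 ->
  run e (Assign k f) p s j x y z =
    if j == k then holds e s (env3 p x y z) f else s j x y z.
Proof.
move=> af k0 j0; rewrite run_Seq run_Fill; last by rewrite /= eq_sym.
case: eqP => _; last by rewrite run_Fill // (negPf j0).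
by rewrite [LHS]run_Fill.
Qed.

End Language.

Arguments run : simpl never.

(* Relations: 1 the graph that is being pruned, 2 the matching, 3 the vertices to
   be covered, 4 failure, 5 positive answer of the test, 6-9 the contracted graph
   with its matching, its vertices to be covered and its uncovered vertex, 10 the
   set [D] of the search, 11 the matchings attached to [D], 12 end of the search,
   13 a blossom, 14 the graph that is tested.
   Variable 20 is never bound, so that it denotes [r]. *)
Definition un (k i : nat) : form := Rel k i i i.
Definition bin (k i j : nat) : form := Rel k i j j.
Definition yes : form := Eq 20 20.
Definition no : form := Neg yes.

(** In the search, variables 8, 9 and 10 stand for [u], [v] and the partner of [v] in the matching
    attached to [u]. This is one step of closing the orbit of [u] under the matchings of [u] and
    [v]. *)
Definition blossom_step : form :=
  Or (Eq 0 8) (Ex 12 (And (un 13 12) (Or (Rel 11 8 12 0) (Rel 11 9 12 0)))).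

Definition contract_form : form :=
  Or (And (un 13 0) (And (Eq 0 8) (And (Neg (un 13 1))
       (Ex 12 (And (un 13 12) (bin 6 12 1))))))
     (And (Neg (un 13 0)) (Or
       (And (un 13 1) (And (Eq 1 8) (Ex 12 (And (un 13 12) (bin 6 12 0)))))
       (And (Neg (un 13 1)) (bin 6 0 1)))).

Definition find_blossom : cmd :=
  Seq (Assign 13 no) (For 11 (Assign 13 blossom_step)).

Definition shrink : cmd :=
  Seq (When (Ex 12 (And (un 13 12) (Neg (un 8 12)))) (Assign 5 yes))
  (Seq (Assign 6 contract_form)
  (Seq (Assign 7 (Or (And (un 13 0) (Eq 0 1)) (And (Neg (un 13 0)) (Rel 11 8 0 1))))
  (Seq (Assign 8 (Or (Eq 0 8) (And (un 8 0) (Neg (un 13 0)))))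
  (Seq (Assign 9 (Eq 0 8)) (Assign 12 yes))))).

Definition rotate_form : form :=
  Or (And (Eq 1 8) (Eq 2 9)) (And (Neg (Eq 1 8))
    (Or (And (Eq 1 9) (Eq 2 8)) (And (Neg (Eq 1 9))
      (Or (And (Eq 1 10) (Eq 2 10)) (And (Neg (Eq 1 10)) (Rel 11 8 1 2)))))).

Definition extend : cmd :=
  Seq (Assign 11 (Or (And (Eq 0 10) rotate_form)
                     (And (Neg (Eq 0 10)) (Rel 11 0 1 2))))
      (Assign 10 (Or (un 10 0) (Eq 0 10))).

Definition exposed : form := Or (Eq 10 9) (Neg (un 8 10)).

Definition grow : cmd :=
  When (And (And (Neg (un 5 20)) (Neg (un 12 20)))
            (And (un 10 8) (And (bin 6 8 9) (Rel 11 8 9 10))))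
  (Seq (When (un 10 9) (Seq find_blossom shrink))
       (When (Neg (un 10 9)) (Seq (When exposed (Assign 5 yes))
          (When (And (Neg exposed) (Neg (un 10 10))) extend)))).

(** Variable 7 only repeats the sweep over all triples, often enough for [D] to stop growing. *)
Definition growth : cmd := For 7 (For 8 (For 9 (For 10 grow))).

Definition round : cmd :=
  Seq (Assign 10 (un 9 0)) (Seq (Assign 11 (bin 7 1 2)) (Seq (Assign 12 no) growth)).

Definition test : cmd :=
  Seq (Assign 6 (bin 14 0 1)) (Seq (Assign 7 (bin 2 0 1)) (Seq (Assign 8 (un 3 0))
  (Seq (Assign 9 (Eq 0 3)) (Seq (Assign 5 no) (For 6 round))))).

(** * Correctness of the search *)

Section Correctness.
Variables (T : finType) (e : rel T).
Implicit Types (s : rels T) (p : nat -> T).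

Definition flag s k b := forall x y z, s k x y z = b.
(** Only the cells read by [un] are constrained; [binv] does the same for [bin]. *)
Definition unv s k (X : {set T}) := forall x, s k x x x = (x \in X).
Definition binv s k (R : rel T) := forall x y, s k x y y = R x y.

Definition valid s h m (W : {set T}) q : Prop :=
  [/\ [/\ binv s 6 h, binv s 7 (fun x y => m x == y), unv s 8 W &
          unv s 9 [set q]], symmetric h, irreflexive h & based h W m q].

Variables (h : rel T) (m : T -> T) (W : {set T}) (q : T).
Hypotheses (h_sym : symmetric h) (h_irr : irreflexive h).

(** A round that is not stuck ends with a positive answer or with an equivalent instance that has
    fewer vertices to cover. *)
Definition finished s : Prop :=
  (flag s 5 true /\ coverable h W) \/
  [/\ flag s 5 false, flag s 12 true & exists h' m' W' q',
    [/\ valid s h' m' W' q', coverable h' W' <-> coverable h W & #|W'| < #|W|]].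

Section Blossom.
Variables (D A : {set T}) (t : T -> T -> T) (p : nat -> T) (s : rels T).
Variables (u v : T).
Hypotheses (p8 : p 8 = u) (p9 : p 9 = v).
Hypotheses (F : forest h W D A t) (uD : u \in D) (vD : v \in D) (huv : h u v).
Hypotheses (tu : forall x y, s 11 u x y = (t u x == y)).
Hypotheses (tv : forall x y, s 11 v x y = (t v x == y)).

Definition spread (X : {set T}) : {set T} :=
  u |: (t u @: X :|: t v @: X).

Lemma spread_mono : {homo spread : X X' / X \subset X'}.
Proof. by move=> X X' XX; rewrite /spread setUS // setUSS ?imsetS. Qed.

(** [fixset] iterates from the empty set [#|T|] times, which is exactly what the loop does. *)
Lemma run_find_blossom :
  unv (run e find_blossom p s) 13 (fixset spread) /\
  (forall j, j != 0 -> j != 13 -> run e find_blossom p s j = s j).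
Proof.
have fr s' p' f j : j != 0 -> j != 13 -> run e (Assign 13 f) p' s' j = s' j.
  by move=> j0 j13; apply: run_frame; rewrite !inE negb_or j0.
rewrite run_Seq run_For; set s1 := run _ _ _ _.
have -> : fixset spread = iter (size (enum T)) spread set0 by rewrite -cardE.
apply: (foldl_ind (I := fun l s' => unv s' 13 (iter (size l) spread set0) /\
  forall j, j != 0 -> j != 13 -> s' j = s j)).
  split=> [x|j j0 j13]; last exact: fr.
  by rewrite /s1 run_Assign //= inE eqxx.
move=> l x s' [s'13 s'j]; split=> [y|j j0 j13]; last by rewrite fr ?s'j.
rewrite run_Assign //= size_rcons /= !inE /env3 /upd /= p8 p9; congr (_ || _).
apply/existsP/orP => [[z /andP[]]|].
  rewrite s'13 s'j // tu tv => zX /orP[/eqP<-|/eqP<-]; first by left; apply: imset_f.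
  by right; apply: imset_f.
by case=> /imsetP[z zX ->]; exists z; apply/andP; split;
  rewrite ?s'13 ?s'j // tu tv eqxx ?orbT.
Qed.

Lemma run_contract :
  binv s 6 h -> unv s 8 W -> flag s 5 false ->
  finished (run e (Seq find_blossom shrink) p s).
Proof.
move=> s6 s8 s5.
have [F1 _ _ _ _] := F.
set C := fixset spread.
have CK : spread C = C := fixsetK spread_mono.
have uC : u \in C by rewrite -CK !inE eqxx.
have fC x : x \in C -> t u x \in C.
  by move=> xC; rewrite -CK !inE (imset_f _ xC) orbT.
have gC x : x \in C -> t v x \in C.
  by move=> xC; rewrite -CK !inE (imset_f _ xC) !orbT.
have C_min (S : {set T}) : u \in S -> (forall x, x \in S -> t u x \in S) ->
    (forall x, x \in S -> t v x \in S) -> C \subset S.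
  move=> uS fS gS; rewrite /C /fixset; elim: #|T| => [|k IHk]; first exact: sub0set.
  apply/subsetP => x; rewrite /= !inE => /or3P[/eqP->//||] /imsetP[y yX ->].
    exact/fS/(subsetP IHk).
  exact/gS/(subsetP IHk).
have [vC crit fcov] := blossom h_sym F uD vD huv uC fC gC C_min.
have bu := F1 u uD.
have vu : v != u by apply: contraTneq huv => ->; rewrite h_irr.
rewrite run_Seq; have [] := run_find_blossom.
set s1 := run e find_blossom p s => s1_13 s1j.
rewrite /shrink run_Seq run_When.
set bad := holds _ _ _ _.
have badE : bad = ~~ (C \subset W).
  rewrite /bad /= /upd /=; apply/existsP/subsetPn => [[x /andP[]]|[x xC xW]].
    by rewrite s1_13 s1j // s8; exists x.
  by exists x; rewrite s1_13 s1j // s8; apply/andP.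
set s2 := if bad then _ else _.
have s2j j : j != 0 -> j != 5 -> s2 j = s1 j.
  by rewrite /s2; case: ifP => // _ j0 j5; apply: run_frame; rewrite !inE negb_or j0.
have s2_5 : flag s2 5 bad.
  move=> x y z; rewrite /s2; case: ifP => _; last by rewrite s1j // s5.
  by rewrite run_Assign //= eqxx.
have s2B x : s2 13 x x x = (x \in C) by rewrite s2j // s1_13.
have s2s j : j != 0 -> j != 13 -> j != 5 -> s2 j = s j.
  by move=> *; rewrite s2j // s1j.
have fr k f p' s' j : j != 0 -> j != k -> run e (Assign k f) p' s' j = s' j.
  by move=> j0 jk; apply: run_frame; rewrite !inE negb_or j0.
rewrite 4!run_Seq.
set s3 := run e (Assign 6 _) p s2.
set s4 := run e (Assign 7 _) p s3.
set s5' := run e (Assign 8 _) p s4.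
set s6' := run e (Assign 9 _) p s5'.
set s7 := run e (Assign 12 _) p s6'.
have s7_5 : flag s7 5 bad by move=> x y z; rewrite /s7 fr // /s6' fr // /s5' fr // /s4 fr // /s3 fr.
have s7_12 : flag s7 12 true.
  by move=> x y z; rewrite /s7 run_Assign //= eqxx.
have [CW|nCW] := boolP (C \subset W); last first.
  left; split; first by move=> x y z; rewrite s7_5 badE nCW.
  have /subsetPn[x xC xW] := nCW.
  exact: (uncovered_blossom bu uC fC crit xC xW).
right; split=> //; first by move=> x y z; rewrite s7_5 badE CW.
exists (contract h C u), (fun x => if x \in C then x else t u x),
  (u |: (W :\: C)), u.
split; last exact: (contract_smaller uC CW vC vu).
  split; [ | exact: contract_sym | exact: contract_irr | exact: contract_based].
  have exE y : [exists x, s2 13 x x x && s2 6 x y y] = [exists b in C, h b y].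
    by apply: eq_existsb => x; rewrite s2B s2s // s6.
  split.
  - move=> x y; rewrite /s7 fr // /s6' fr // /s5' fr // /s4 fr // /s3 run_Assign //= /env3 /upd /= p8.
    rewrite !exE !s2B s2s // s6 /contract.
    by case: (x \in C); case: (y \in C); rewrite /= ?andbF ?orbF.
  - move=> x y; rewrite /s7 fr // /s6' fr // /s5' fr // /s4 run_Assign //= /env3 /upd /= p8.
    by rewrite /s3 !fr // s2B s2s // tu; case: (x \in C); rewrite /= ?orbF.
  - move=> x; rewrite /s7 fr // /s6' fr // /s5' run_Assign //= /env3 /upd /= p8.
    by rewrite /s4 /s3 !fr // s2B s2s // s8 !inE andbC.
  move=> x; rewrite /s7 fr // /s6' run_Assign //= /env3 /upd /= p8.
  by rewrite inE.
split; first exact: (contract_sound h_sym uC crit).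
exact: (contract_complete bu uC fC fcov CW).
Qed.

End Blossom.
Definition growing s : Prop :=
  [/\ flag s 5 false, flag s 12 false, valid s h m W q &
    exists (D A : {set T}) (t : T -> T -> T), [/\ unv s 10 D, forest h W D A t &
      forall u x y, u \in D -> s 11 u x y = (t u x == y)]].

Definition labelled s : {set T} := [set x | s 10 x x x].

Definition idle p s : Prop :=
  s 10 (p 8) (p 8) (p 8) -> s 6 (p 8) (p 9) (p 9) -> s 11 (p 8) (p 9) (p 10) ->
  ~~ s 10 (p 9) (p 9) (p 9) && s 10 (p 10) (p 10) (p 10).

(** [E] is what is learnt about the state when [act] leaves it unchanged. *)
Definition advances (act : rels T -> rels T) (E : rels T -> Prop) : Prop :=
  forall s, growing s -> finished (act s) \/
    growing (act s) /\ (#|labelled s| < #|labelled (act s)| \/ act s = s /\ E s).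

Lemma run_grow_finished p s : finished s -> run e grow p s = s.
Proof.
by move=> fin; rewrite run_When /=; case: fin => [[-> _]|[_ -> _]]; rewrite ?andbF.
Qed.

(** For an edge from [u] in [D] to [v]: [v] in [D] gives a blossom; [v] unmatched, or with a partner
    outside [W], gives a covering; a partner already in [D] changes nothing; any other partner joins
    [D]. *)
Lemma advances_grow p : advances (run e grow p) (idle p).
Proof.
move=> s [s5 s12 [[s6 s7 s8 s9] _ _ bm] [D [A [t [s10 F tE]]]]].
have F1 := let: And5 F1 _ _ _ _ := F in F1.
have gr : growing s.
  by split=> //; exists D, A, t.
rewrite run_When; case: ifP => [|/negbT guard]; last first.
  right; split=> //; right; split=> // D8 h89 t8910.
  by case/negP: guard; rewrite /= s5 s12 D8 h89 t8910.
rewrite /= s5 s12 s10 s6 => /= /and3P[uD huv]; rewrite tE // => /eqP tw.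
rewrite run_Seq; set s1 := run e (When (un 10 9) _) p s.
have s1_10 : s1 10 = s 10 by apply: run_frame.
rewrite run_When /= s1_10 s10; have [vD|vD] := boolP (p 9 \in D).
  left; rewrite /s1 run_When /= s10 vD.
  exact: (run_contract erefl erefl F uD vD huv
    (fun x y => tE _ x y uD) (fun x y => tE _ x y vD) s6 s8 s5).
have {s1_10}-> : s1 = s by rewrite /s1 run_When /= s10 (negPf vD).
rewrite run_Seq; set s2 := run e (When exposed _) p s.
have s2_8 : s2 8 = s 8.
  by rewrite /s2 run_When; case: ifP => // _; apply: run_frame.
have exE : holds e s p exposed = (p 10 == p 9) || (p 10 \notin W).
  by rewrite /= s8.
have ex2 : holds e s2 p exposed = holds e s p exposed by rewrite /= s2_8.
have notE f s' : holds e s' p (And (Neg exposed) f) =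
    ~~ holds e s' p exposed && holds e s' p f by [].
rewrite run_When notE ex2 exE; have [ex|nex] := boolP (_ || _).
  left; left; split.
    by move=> x y z; rewrite /s2 run_When exE ex /= run_Assign //= eqxx.
  apply: (rotate_coverable h_sym h_irr (F1 _ uD) huv).
  by rewrite tw; case/orP: ex => [/eqP|]; [left | right].
have {s2_8 ex2}-> : s2 = s by rewrite /s2 run_When exE (negPf nex).
right; move: nex; rewrite /= negb_or negbK => /andP[wv wW].
rewrite s10; have [wD|wD] := boolP (p 10 \in D).
  by split=> //; right; split=> // _ _ _; rewrite !s10 wD vD.
move=> {s1 s2 exE notE} /=.
set u := p 8 in uD huv tw *; set v := p 9 in vD huv tw wv *.
set w := p 10 in tw wv wW wD *.
set s1 := run e _ p s; pose t' x := if x == w then rotate (t u) u v else t x.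
have s1j j : j != 0 -> j != 10 -> j != 11 -> s1 j = s j.
  by move=> j0 j10 j11; apply: run_frame; rewrite !inE !negb_or j0 j10 j11.
have s1_10 : unv s1 10 (w |: D).
  move=> x; rewrite /s1 run_Seq run_Assign //= /env3 /upd /= !inE.
  by rewrite (@run_frame _ _ 10) // s10 orbC.
split.
  split; [by move=> x y z; rewrite s1j | by move=> x y z; rewrite s1j | |].
    split=> //; split=> [x y|x y|x|x]; rewrite s1j //.
  exists (w |: D), (v |: A), t'; split=> //.
    exact: (forest_grow h_sym h_irr F uD huv vD tw wv wD wW (fun=> frefl _)).
  move=> x y z xD; rewrite /s1 run_Seq (@run_frame _ _ 11) // run_Assign //=.
  rewrite /env3 /upd /= -/u -/v -/w /t'.
  have [xw|xw] := eqVneq x w.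
    rewrite /= orbF /rotate tw tE // ![z == _]eq_sym.
    have [_|yu] := eqVneq y u; first by rewrite /= orbF.
    have [_|yv] := eqVneq y v; first by rewrite /= orbF.
    by have [->|yw] := eqVneq y w; rewrite /= ?orbF.
  by move: xD; rewrite !inE (negPf xw) /= => xD; rewrite tE.
left; apply: proper_card; apply/properP; split.
  by apply/subsetP => x; rewrite !inE s10 s1_10 !inE => ->; rewrite orbT.
by exists w; rewrite inE ?s1_10 ?s10 ?inE ?eqxx.
Qed.

Lemma foldl_finished (act : rels T -> T -> rels T) l s :
  (forall x s, finished s -> act s x = s) -> finished s -> foldl act s l = s.
Proof. by move=> fin fs; elim: l => //= x l IHl; rewrite fin. Qed.

(** If the labelled set has not grown, no step has changed the state, so all the facts [E x] hold of
    one and the same state. *)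
Lemma advances_foldl (act : rels T -> T -> rels T) (E : T -> rels T -> Prop) l :
  (forall x s, finished s -> act s x = s) ->
  (forall x, advances (act^~ x) (E x)) ->
  advances (fun s => foldl act s l) (fun s => forall x, x \in l -> E x s).
Proof.
move=> fin adv; elim: l => [|x l IHl] s gs /=; first by right; split=> //; right.
have [fs|[gs1 up]] := adv x s gs; first by left; rewrite foldl_finished.
have [fs|[gs2 up2]] := IHl _ gs1; [by left | right; split=> //].
case: up => [lt1|[sE Ex]].
  by left; case: up2 => [lt2|[-> _]] //; apply: ltn_trans lt2.
move: up2; rewrite sE; case=> [lt2|[-> El]]; [by left | right; split=> //].
by move=> y; rewrite inE => /predU1P[->|/El].
Qed.

Lemma idle_stuck s : growing s ->
  (forall p, idle p s) -> ~ coverable h W.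
Proof.
case=> s5 s12 [[s6 _ _ _] _ _ _] [D [A [t [s10 F tE]]]] id.
apply: (forest_stuck F) => u v uD huv.
pose p := upd (upd (upd (fun=> q) 8 u) 9 v) 10 (t u v).
have := id p; rewrite /idle /p /upd /= !s10 s6 tE // eqxx.
by move=> /(_ uD huv isT) /andP[].
Qed.

(** A sweep that neither finishes nor enlarges [D] shows that the forest is stuck. Otherwise [#|T|]
    sweeps would make [D] larger than the vertex set. *)
Lemma run_growth p s : growing s -> finished (run e growth p s) \/
  growing (run e growth p s) /\ ~ coverable h W.
Proof.
move=> gs; rewrite run_For; set act := fun _ _ => _.
have fin10 p' x s' : finished s' -> run e grow (upd p' 10 x) s' = s'.
  exact: run_grow_finished.
have fin9 p' x s' : finished s' -> run e (For 10 grow) (upd p' 9 x) s' = s'.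
  exact/foldl_finished/fin10.
have fin8 p' x s' : finished s' ->
    run e (For 9 (For 10 grow)) (upd p' 8 x) s' = s'.
  exact/foldl_finished/fin9.
have adv x : advances (act^~ x) (fun s => forall u, u \in enum T ->
    forall v, v \in enum T -> forall w, w \in enum T ->
    idle (upd (upd (upd (upd p 7 x) 8 u) 9 v) 10 w) s).
  apply: (@advances_foldl (fun s' u => run e (For 9 (For 10 grow)) (upd _ 8 u) s')
    (fun u s => forall v, v \in enum T -> forall w, w \in enum T -> idle _ s)).
    exact: fin8.
  move=> u; apply: (@advances_foldl (fun s' v => run e (For 10 grow) (upd _ 9 v) s')
    (fun v s => forall w, w \in enum T -> idle _ s)).
    exact: fin9.
  move=> v; apply: (@advances_foldl (fun s' w => run e grow (upd _ 10 w) s')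
    (fun w s => idle _ s)).
    exact: fin10.
  by move=> w; apply: advances_grow.
have : finished (foldl act s (enum T)) \/ growing (foldl act s (enum T)) /\
    (~ coverable h W \/ size (enum T) < #|labelled (foldl act s (enum T))|).
  apply: (foldl_ind (I := fun l s' => finished s' \/ growing s' /\
    (~ coverable h W \/ size l < #|labelled s'|))).
    right; split=> //; right; case: gs => _ _ _ [D [A [t [s10 F _]]]].
    have [_ _ _ _ AD] := F; rewrite (_ : labelled s = D).
      exact: leq_ltn_trans AD.
    by apply/setP => x; rewrite inE s10.
  move=> l x s' [fs'|[gs' s'P]].
    left.
    by rewrite /act run_For foldl_finished // => y s2; apply: fin8.
  have [fs1|[gs1 up]] := adv x s' gs'; [by left | right; split=> //].
  case: s'P => [nc|lt1]; first by left.
  case: up => [lt2|[_ id]]; first by right; rewrite size_rcons; apply: leq_ltn_trans lt2.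
  left; apply: (idle_stuck gs') => p' D8 h89 t8910.
  by apply: (id (p' 8) _ (p' 9) _ (p' 10) _ D8 h89 t8910); rewrite mem_enum.
case=> [fs|[gs' [nc|]]]; [by left | by right | ].
by rewrite -cardE ltnNge max_card.
Qed.

Lemma frame_Assign k f p s j :
  j != 0 -> j != k -> run e (Assign k f) p s j = s j.
Proof. by move=> j0 jk; apply: run_frame; rewrite !inE negb_or j0. Qed.

Lemma run_round p s : flag s 5 false -> valid s h m W q ->
  finished (run e round p s) \/
  [/\ flag (run e round p s) 5 false, valid (run e round p s) h m W q
    & ~ coverable h W].
Proof.
move=> s5 val; have [[s6 s7 s8 s9] _ _ bm] := val.
rewrite /round; do 3 rewrite run_Seq.
set s1 := run e (Assign 10 _) p s; set s2 := run e (Assign 11 _) p s1.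
set s3 := run e (Assign 12 _) p s2.
have s3j j : j \notin [:: 0; 10; 11; 12] -> s3 j = s j.
  rewrite !inE !negb_or => /and4P[j0 j10 j11 j12].
  by rewrite /s3 frame_Assign // /s2 frame_Assign // /s1 frame_Assign.
have [|fs|[[s5' _ val' _] nc]] := run_growth p (s := s3); [ | by left | by right].
split.
- by move=> x y z; rewrite s3j.
- by move=> x y z; rewrite /s3 run_Assign //= eqxx.
- by split=> //; split=> [x y|x y|x|x]; rewrite s3j.
exists [set q], set0, (fun=> m); split.
- move=> x; rewrite /s3 frame_Assign // /s2 frame_Assign // /s1 run_Assign //=.
- exact: (forest1 bm).
move=> x y z _; rewrite /s3 frame_Assign // /s2 run_Assign //=.
by rewrite /s1 frame_Assign //; apply: s7.
Qed.

Lemma run_round_true p s : flag s 5 true -> flag (run e round p s) 5 true.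
Proof.
move=> s5; rewrite /round; do 3 rewrite run_Seq.
set s1 := run e (Assign 10 _) p s; set s2 := run e (Assign 11 _) p s1.
set s3 := run e (Assign 12 _) p s2.
have s35 : flag s3 5 true.
  move=> x y z; rewrite /s3 frame_Assign // /s2 frame_Assign // /s1.
  by rewrite frame_Assign.
have id (act : rels T -> T -> rels T) l : (forall x, act s3 x = s3) ->
    foldl act s3 l = s3.
  by move=> actE; elim: l => //= x l; rewrite actE.
rewrite /growth run_For id // => x; rewrite run_For id // => y.
rewrite run_For id // => z; rewrite run_For id // => w.
by rewrite run_When /= s35.
Qed.

End Correctness.

(** If [W] can be covered, no round gets stuck, so each round without a positive answer shrinks the
    set to be covered. That set always contains its uncovered vertex, hence [#|T|] rounds
    suffice. *)
Lemma run_test (T : finType) (e h : rel T) m (W : {set T}) p s :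
  binv s 14 h -> binv s 2 (fun x y => m x == y) -> unv s 3 W ->
  symmetric h -> irreflexive h -> based h W m (p 3) ->
  exists b, flag (run e test p s) 5 b /\ (b <-> coverable h W).
Proof.
move=> s14 s2 s3 h_sym h_irr bm.
rewrite /test; do 5 rewrite run_Seq.
set t1 := run e (Assign 6 _) p s; set t2 := run e (Assign 7 _) p t1.
set t3 := run e (Assign 8 _) p t2; set t4 := run e (Assign 9 _) p t3.
set t5 := run e (Assign 5 _) p t4.
have val : valid t5 h m W (p 3).
  split=> //; split=> [x y|x y|x|x]; rewrite /t5 frame_Assign //.
  - rewrite /t4 frame_Assign // /t3 frame_Assign // /t2 frame_Assign //.
    by rewrite /t1 run_Assign //=; apply: s14.
  - rewrite /t4 frame_Assign // /t3 frame_Assign // /t2 run_Assign //=.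
    by rewrite /t1 frame_Assign //; apply: s2.
  - rewrite /t4 frame_Assign // /t3 run_Assign //=.
    by rewrite /t2 frame_Assign // /t1 frame_Assign //; apply: s3.
  by rewrite /t4 run_Assign //= inE.
have t5_5 : flag t5 5 false by move=> x y z; rewrite /t5 run_Assign //= eqxx.
rewrite run_For.
have : flag (foldl (fun s x => run e round (upd p 6 x) s) t5 (enum T)) 5 true /\
    coverable h W \/
  flag (foldl (fun s x => run e round (upd p 6 x) s) t5 (enum T)) 5 false /\
    exists h' m' (W' : {set T}) q',
    [/\ valid (foldl (fun s x => run e round (upd p 6 x) s) t5 (enum T)) h' m' W' q',
     coverable h' W' <-> coverable h W &
     coverable h W -> #|W'| + size (enum T) <= #|W|].
  apply: (foldl_ind (I := fun l s' => flag s' 5 true /\ coverable h W \/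
    flag s' 5 false /\ exists h' m' (W' : {set T}) q', [/\ valid s' h' m' W' q',
      coverable h' W' <-> coverable h W &
      coverable h W -> #|W'| + size l <= #|W|])).
    by right; split=> //; exists h, m, W, (p 3); rewrite addn0.
  move=> l x s' [[s'5 cov]|[s'5 [h' [m' [W' [q' [val' cov' le']]]]]]].
    by left; split=> //; apply: run_round_true.
  have [_ hs hi _] := val'.
  have [fin|[r5 rval nc]] := run_round e hs hi (upd p 6 x) s'5 val'.
    case: fin => [[r5 cov]|[r5 _ [h2 [m2 [W2 [q2 [val2 cov2 lt2]]]]]]].
      by left; split=> //; apply/cov'.
    right; split=> //; exists h2, m2, W2, q2; split=> // [|cov].
      exact: iff_trans cov2 cov'.
    by have := le' cov; rewrite size_rcons; lia.
  right; split=> //; exists h', m', W', q'; split=> // cov.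
  by case: nc; apply/cov'.
set s' := foldl _ _ _; case=> [[s'5 cov]|[s'5 [h' [m' [W' [q' [[_ _ _ b'] _ le']]]]]]].
  by exists true.
exists false; split=> //; split=> // cov.
have [_ qW _ _] := b'; have W'0 : 0 < #|W'| by apply/card_gt0P; exists q'.
have := leq_trans (le' cov) (max_card _).
by rewrite -cardE -[X in _ <= X]add0n leq_add2r leqNgt W'0.
Qed.

(** * Pruning and the outer loop *)

Definition far_form (i : nat) : form := And (Neg (Eq i 20)) (Neg (Edge i 20)).

Definition fresh_form (i j : nat) : form := And (bin 1 i j) (Neg (bin 2 i j)).

Definition cut_form : form :=
  And (bin 1 0 1) (Neg (Or (And (Eq 0 4) (Eq 1 5)) (And (Eq 0 5) (Eq 1 4)))).

Definition combine_form : form :=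
  Or (fresh_form 0 1) (And (Neg (Ex 12 (fresh_form 0 12)))
    (Or (And (bin 2 0 1) (Neg (Ex 12 (fresh_form 1 12))))
        (And (Eq 0 1) (Ex 12 (And (bin 2 0 12) (Ex 13 (fresh_form 12 13))))))).

Definition prune_edge : cmd :=
  When (fresh_form 4 5)
    (Seq (Assign 14 cut_form) (Seq test (When (un 5 20) (Assign 1 (bin 14 0 1))))).

Definition prune : cmd := For 4 (For 5 prune_edge).

Definition enlarge : cmd :=
  When (And (far_form 3) (And (bin 2 3 3) (Neg (un 4 20))))
  (Seq (Assign 1 (And (Edge 0 1) (And (Neg (Eq 0 20)) (Neg (Eq 1 20)))))
  (Seq (Assign 3 (Or (And (far_form 0) (Neg (bin 2 0 0))) (Eq 0 3)))
  (Seq (Assign 14 (bin 1 0 1))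
  (Seq test
  (Seq (When (Neg (un 5 20)) (Assign 4 yes))
       (When (Neg (un 4 20)) (Seq prune (Assign 2 combine_form)))))))).

Definition main : cmd :=
  Seq (Assign 2 (Eq 0 1)) (Seq (Assign 4 no) (For 3 enlarge)).

Lemma coverable_sub (T : finType) (g g' : rel T) (Y Y' : {set T}) :
  subrel g g' -> Y' \subset Y -> coverable g Y -> coverable g' Y'.
Proof.
move=> gg YY [N [[NK Ng] NY]]; exists N; split; last first.
  by move=> y yY; apply/NY/(subsetP YY).
by split=> // x Nx; apply/gg/Ng.
Qed.

Section Cut.
Variables (T : finType) (g : rel T).
Hypothesis g_sym : symmetric g.

Definition cut (a b : T) : rel T :=
  fun x y => g x y && ~~ ((x == a) && (y == b) || (x == b) && (y == a)).

Lemma cut_sym a b : symmetric (cut a b).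
Proof.
move=> x y; rewrite /cut g_sym; congr (_ && ~~ _).
by rewrite orbC; congr (_ || _); rewrite andbC.
Qed.

Lemma cut_matching m a b : matching g m -> m a != b -> matching (cut a b) m.
Proof.
move=> [mK mg] mab; split=> // x mx; rewrite /cut mg //= negb_or.
apply/andP; split; apply: contra mab => /andP[/eqP-> /eqP <-] //.
by rewrite mK.
Qed.

(** An edge missing from [N] could be deleted without harming [N]. *)
Lemma tight_matching m N (Y : {set T}) :
  matching g N -> covers N Y ->
  (forall a b, g a b -> m a != b -> ~ coverable (cut a b) Y) ->
  forall x y, g x y -> m x != y -> N x = y.
Proof.
move=> NG NY nocut x y gxy mxy; apply/eqP; apply: contraT => Nxy.
by case: (nocut x y gxy mxy); exists N; split=> //; apply: cut_matching.
Qed.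

End Cut.

Section Outer.
Variables (T : finType) (e : rel T) (r : T).
Hypotheses (e_sym : symmetric e) (e_irr : irreflexive e).

Let g0 := delete_vertex e r.

Section Prune.
Variables (m : T -> T) (Y : {set T}) (x0 : T) (s0 : rels T).
Hypotheses (m2 : binv s0 2 (fun x y => m x == y)) (Y3 : unv s0 3 Y).

(** [P] holds of the pairs already tried. *)
Definition pruned (P : T -> T -> Prop) (s : rels T) : Prop :=
  (forall j, j \in [:: 2; 3; 4] -> s j = s0 j) /\ exists g,
  [/\ binv s 1 g, symmetric g /\ irreflexive g, subrel g g0,
      based g Y m x0 /\ coverable g Y &
      forall a b, P a b -> g a b -> m a != b -> ~ coverable (cut g a b) Y].

Lemma pruned_sub P P' s :
  (forall a b, P' a b -> P a b) -> pruned P s -> pruned P' s.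
Proof.
move=> PP [fr [g [g1 gs gg gb gP]]]; split=> //; exists g; split=> // a b Pab.
by apply: gP; apply: PP.
Qed.

Lemma run_prune_edge (P : T -> T -> Prop) p s : p 3 = x0 -> p 20 = r ->
  pruned P s ->
  pruned (fun a b => P a b \/ a = p 4 /\ b = p 5) (run e prune_edge p s).
Proof.
move=> p3 p20 [fr [g [g1 [gs gi] gg [gb gc] gP]]].
set a := p 4; set b := p 5.
have s2 : binv s 2 (fun x y => m x == y) by rewrite /binv fr.
rewrite run_When; have -> : holds e s p (fresh_form 4 5) = g a b && (m a != b).
  by rewrite /= g1 s2.
case: ifP => [/andP[gab mab]|nab]; last first.
  split=> //; exists g; split=> // a' b' [Pab|[-> ->] gab mab]; first exact: gP.
  by rewrite gab mab in nab.
rewrite run_Seq; set s1 := run e (Assign 14 _) p s.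
rewrite run_Seq; set s2' := run e test p s1.
have s1j j : j \notin [:: 0; 14] -> s1 j = s j.
  by rewrite !inE negb_or => /andP[j0 j14]; apply: frame_Assign.
have s2j j : j \in [:: 1; 2; 3; 4; 14] -> s2' j = s1 j.
  by rewrite !inE => jP; apply: run_frame; case/or4P: jP => [||| /orP[]] /eqP->.
have s1_14 : binv s1 14 (cut g a b).
  by move=> x y; rewrite /s1 run_Assign //= g1.
have cb : based (cut g a b) Y m (p 3).
  rewrite p3; case: gb => mm Yx mx mY; split=> //; exact: cut_matching.
have cs := cut_sym gs a b.
have ci : irreflexive (cut g a b) by move=> x; rewrite /cut gi.
have [||c [s5 cP]] := run_test e (s := s1) s1_14 _ _ cs ci cb.
- by rewrite /binv s1j.
- by rewrite /unv s1j // fr.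
have fr2 j : j \in [:: 2; 3; 4] -> s2' j = s0 j.
  move=> jP; rewrite s2j; last by move: jP; rewrite !inE => /or3P[] /eqP->.
  rewrite s1j ?fr //; by move: jP; rewrite !inE => /or3P[] /eqP->.
rewrite -/s2' in s5.
rewrite run_When /= s5; case: c cP s5 => cP s5.
  split.
    move=> j jP; rewrite frame_Assign ?fr2 //; by move: jP; rewrite !inE => /or3P[] /eqP->.
  exists (cut g a b); split=> //.
  - by move=> x y; rewrite run_Assign //= s2j // s1_14.
  - by move=> x y /andP[/gg].
  - by split; [rewrite -p3 | apply/cP].
  move=> a' b' [Pab|[-> ->]]; rewrite {1}/cut; last by rewrite !eqxx andbF.
  (* An edge found indispensable earlier remains so in a smaller graph. *)
  case/andP=> gab' _ mab' cc; apply: (gP a' b' Pab gab' mab').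
  by apply: coverable_sub cc => // x y /andP[/andP[gxy _] nxy]; rewrite /cut gxy.
split=> //; exists g; split=> //.
  by move=> x y; rewrite s2j // s1j // g1.
by move=> a' b' [Pab|[-> ->]]; [apply: gP | move=> _ _ /cP].
Qed.

Lemma run_prune p s : p 3 = x0 -> p 20 = r ->
  pruned (fun _ _ => False) s -> pruned (fun _ _ => True) (run e prune p s).
Proof.
move=> p3 p20 s_pr; rewrite /prune run_For.
apply: (@pruned_sub (fun a b => a \in enum T)).
  by move=> a b _; rewrite mem_enum.
apply: (foldl_ind (I := fun l s' => pruned (fun a b => a \in l) s')).
  exact: pruned_sub s_pr.
move=> l a s' s'P; rewrite run_For.
apply: (@pruned_sub (fun a' b' => a' \in l \/ a' = a /\ b' \in enum T)).
  by move=> a' b'; rewrite mem_rcons inE mem_enum => /orP[/eqP->|->]; [right | left].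
apply: (foldl_ind (I := fun l' s' =>
  pruned (fun a' b' => a' \in l \/ a' = a /\ b' \in l') s')).
  by apply: pruned_sub s'P => a' b' [//|[]].
move=> l' b s2 s2P.
apply: (pruned_sub _ (run_prune_edge (p := upd (upd p 4 a) 5 b) p3 p20 s2P)).
move=> a' b'; rewrite mem_rcons inE => -[al|[-> /orP[/eqP->|bl]]].
- by left; left.
- by right.
- by left; right.
Qed.

End Prune.

Definition enlarged (l : seq T) (s : rels T) : Prop :=
  (flag s 4 true /\ ~ coverable g0 (far e r)) \/
  (flag s 4 false /\ exists m, [/\ matching g0 m,
    binv s 2 (fun x y => m x == y) &
    forall y, y \in far e r -> y \in l -> m y != y]).

Lemma run_enlarge l p s : p 20 = r -> enlarged l s ->
  enlarged (rcons l (p 3)) (run e enlarge p s).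
Proof.
move=> p20; case=> [[s4 nc]|[s4 [m [mm s2 ml]]]].
  by left; rewrite run_When /= s4 /= !andbF.
set x := p 3.
have [g0_sym g0_irr] : symmetric g0 /\ irreflexive g0.
  split=> [y z|y]; rewrite /g0 /delete_vertex ?e_irr // e_sym.
  by rewrite [(z != r) && _]andbC.
have farE y : (y != r) && ~~ e y r = (y \in far e r) by rewrite inE.
rewrite run_When.
have -> : holds e s p (And (far_form 3) (And (bin 2 3 3) (Neg (un 4 20)))) =
    (x \in far e r) && (m x == x).
  by rewrite /= p20 s4 s2 farE andbT.
case: ifP => [/andP[xf /eqP mx]|nx]; last first.
  right; split=> //; exists m; split=> // y yf; rewrite mem_rcons inE.
  case/predU1P => [yx|]; last exact: ml.
  by move: nx; rewrite -yx yf /= => ->.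
rewrite run_Seq; set s1 := run e (Assign 1 _) p s.
rewrite run_Seq; set s3 := run e (Assign 3 _) p s1.
rewrite run_Seq; set s5 := run e (Assign 14 _) p s3.
rewrite run_Seq; set s6 := run e test p s5.
rewrite run_Seq; set s7 := run e (When _ (Assign 4 yes)) p s6.
(* One more far vertex is demanded than [m] covers, so [m] is based at [x] for this set. *)
pose Y := [set y in far e r | m y != y] :|: [set x].
have s6j j : j \in [:: 1; 2; 3; 4; 14] -> s6 j = s5 j.
  by rewrite !inE => jP; apply: run_frame; case/or4P: jP => [||| /orP[]] /eqP->.
have s1_1 : binv s1 1 g0 by move=> y z; rewrite /s1 run_Assign //= /env3 /upd /= p20.
have s5_14 : binv s5 14 g0.
  by move=> y z; rewrite /s5 run_Assign //= /s3 frame_Assign // s1_1.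
have s5_1 : binv s5 1 g0.
  by move=> y z; rewrite /s5 frame_Assign // /s3 frame_Assign // s1_1.
have s5_2 : binv s5 2 (fun x y => m x == y).
  move=> y z; rewrite /s5 frame_Assign // /s3 frame_Assign // /s1.
  by rewrite frame_Assign.
have s5_3 : unv s5 3 Y.
  move=> y; rewrite /s5 frame_Assign // /s3 run_Assign //= /env3 /upd /= p20.
  by rewrite /s1 frame_Assign // s2 farE !inE.
have s5_4 : flag s5 4 false.
  move=> y z w; rewrite /s5 frame_Assign // /s3 frame_Assign // /s1.
  by rewrite frame_Assign.
have bY : based g0 Y m (p 3).
  split=> //; first by rewrite !inE eqxx orbT.
  by move=> y; rewrite !inE => /orP[/andP[_]|] // ->.
have [c [s6_5 cP]] := run_test e (s := s5) s5_14 s5_2 s5_3 g0_sym g0_irr bY.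
rewrite -/s6 in s6_5.
have YS : Y \subset far e r.
  by apply/subsetP => y /setUP[|/set1P->] //; rewrite in_set => /andP[].
rewrite run_When /s7 !run_When /= s6_5; case: c cP s6_5 => cP s6_5 /=; last first.
  rewrite run_Assign //= eqxx /=; left; split.
    by move=> y z w; rewrite run_Assign //= eqxx.
  move=> cov; suff : false by []; apply/cP.
  (* Since [Y] lies within [far], a negative test already rules out covering [far]. *)
  exact: (coverable_sub (fun _ _ => id) YS cov).
rewrite s6j // s5_4 /= run_Seq; set s8 := run e prune p s6.
have : pruned m Y x s6 (fun _ _ => True) s8.
  apply: run_prune => //.
  - by rewrite /binv s6j.
  - by rewrite /unv s6j.
  split=> //; exists g0; split=> //; first by rewrite /binv s6j.
  by split; [| apply/cP].
case=> fr [g [g1 [gs gi] gg [gb [N [NG NY]]] gP]].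
have [mg _ _ _] := gb.
have tight := tight_matching NG NY (fun a b => gP a b I).
right; split.
  by move=> y z w; rewrite frame_Assign // fr // s6j.
exists (combine g m N); split.
- have [K G] := combine_matching gs mg NG tight.
  by split=> // y /G /gg.
- have s8_2 : binv s8 2 (fun x y => m x == y) by rewrite /binv fr // s6j.
  move=> y z; rewrite run_Assign //= /env3 /upd /= (combineE tight) /fresh.
  have exE v : [exists w, s8 1 v w w && ~~ s8 2 v w w] =
      [exists w, g v w && (m v != w)].
    by apply: eq_existsb => w; rewrite g1 s8_2.
  rewrite !exE g1 s8_2; congr (_ || (_ && (_ || (_ && _)))).
  apply/existsP/existsP => [[v]|[v vP]].
    by rewrite s8_2 exE => /andP[/eqP-> /existsP].
  by exists (m y); rewrite s8_2 eqxx exE; apply/existsP; exists v.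
move=> y yf yl; apply: (combine_covers gs mg NG NY tight).
apply/setUP; move: yl; rewrite mem_rcons in_cons => /predU1P[->|yl].
  by right; apply: set11.
by left; rewrite in_set yf ml.
Qed.

Lemma run_main : holds e (run e main (fun=> r) (fun _ _ _ _ => false))
    (fun=> r) (Neg (un 4 20)) <-> coverable g0 (far e r).
Proof.
rewrite /main run_Seq; set s1 := run e (Assign 2 _) _ _.
rewrite run_Seq; set s2 := run e (Assign 4 _) _ _.
rewrite run_For.
have : enlarged (enum T)
    (foldl (fun s x => run e enlarge (upd (fun=> r) 3 x) s) s2 (enum T)).
  apply: (foldl_ind (I := enlarged)) => [|l x s' s'P]; last exact: run_enlarge.
  right; split; first by move=> x y z; rewrite /s2 run_Assign //= eqxx.
  exists id; split=> //; first by split=> // x; rewrite eqxx.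
  by move=> x y; rewrite /s2 frame_Assign // /s1 run_Assign.
set s := foldl _ _ _; case=> [[s4 nc]|[s4 [m [mm _ ml]]]] /=; rewrite s4.
  by split.
split=> // _; exists m; split=> // y yf; apply: ml => //; exact: mem_enum.
Qed.

End Outer.

Theorem theorem6 :
  exists (P : program) (c d : nat),
    forall (T : finType) (e : rel T) (r : T),
      symmetric e -> irreflexive e -> connected e -> diameter e = 2 ->
      decides_within P (encode e r) (c * #|T| ^ d + c) (stackable e r).
Proof.
have [c [d cd]] := machine_decides main (Neg (un 4 20)).
exists (machine main (Neg (un 4 20))), c, d => T e r e_sym e_irr _ diam.
have [hal ans] := cd T e r; split=> //.
apply: (iff_trans ans); apply: (iff_trans (run_main r e_sym e_irr)).
by split; [apply: coverable_stackable | apply: stackable_coverable].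
Qed.
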